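(* The Mysticeti-Lifefin protocol (as specified in the context), run by $n=3f+1$ nodes of which at most $f$ are Byzantine in the partial synchrony model, satisfies safety: if a correct node delivers a transaction $tx$ before a transaction $tx'$, then no correct node delivers $tx'$ without first delivering $tx$ (i.e., all correct nodes have the same prefix ledger).
   Context: **Model.** There are $n=3f+1$ nodes $N_1,\dots,N_n$. A static, computationally bounded adversary corrupts up to $f$ nodes (Byzantine, arbitrary behaviour); the others are correct and always follow the protocol. There is a public-key infrastructure with digital signatures; $\langle m\rangle_i$ is $m$ signed by $N_i$. Partial synchrony: there are an unknown time GST and a known bound $\Delta$ such that any message sent by a correct node after GST arrives within $\Delta$. Each correct node has bounded resources: it stores a limited number of unprocessed messages and cannot accept or create new ones once its resources are exhausted. Clients continuously submit transactions. **Agreement on common subset (ACS).** Each $N_i$ may call $\mathit{acs\_propose}_i(m)$ and may output $\mathit{acs\_decide}_i(V)$. Validity: if a correct node outputs $V$, then $|V|\ge n-f$ and $V$ includes proposals from at least $n-2f$ correct nodes that invoked $\mathit{acs\_propose}$. Agreement: if a correct node outputs $V$, every correct node outputs $V$. Termination: if every correct node proposes, every correct node outputs. $V$ contains at most one proposal per node. **Mysticeti (optimistic path, mode OP).** Execution proceeds in rounds. In round $r$ each node disseminates by best-effort broadcast a vertex carrying transactions, references (hashes) to at least $2f+1$ vertices of round $r-1$ from distinct nodes, its round and its creator (a correct node creates at most one vertex per round; Byzantine nodes may equivocate). After receiving $2f+1$ round-$r$ vertices a node moves to round $r+1$. $DAG_i[r]$ is the set of round-$r$ vertices held by $N_i$;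 a node references a leader vertex only if it holds its whole causal history. Each round $r$ has a predefined leader node $L_r$ (deterministic in $r$), whose round-$r$ vertex is the leader vertex $v_L^r$. Patterns: a *skip pattern* for a round-$r$ vertex $v$ is a set of at least $2f+1$ round-$(r+1)$ vertices (distinct creators) that do not reference $v$; a *certificate pattern* for $v$ is a set of at least $2f+1$ round-$(r+1)$ vertices (distinct creators) that reference $v$. A vertex of round $>r+1$ whose causal history includes a certificate pattern for $v$ is a *certificate* for $v$. Decision rules. Direct: $v_L^r$ is marked to-commit if $N_i$ sees $2f+1$ round-$(r+2)$ vertices (distinct creators) that are certificates for $v_L^r$; to-skip if $N_i$ sees a skip pattern for it; otherwise undecided. Indirect, for a directly undecided $v_L^r$: let $v_L^{r'}$ be the first subsequent leader vertex with $r'>r+2$ marked to-commit or undecided. If it is to-commit, then $v_L^r$ is to-commit when $v_L^{r'}$ causally references a certificate pattern over $v_L^r$ and to-skip otherwise; if it is undecided, $v_L^r$ is undecided. Procedure try_decide processes leader rounds from the current round down to $\mathit{committedRound}+1$ with these rules, then takes, in increasing round order, the longest prefix of decided leaders and finalizes it; the to-commit leader vertices together with their not-yet-ordered causal histories are ordered by a fixed deterministic algorithm and their transactions delivered. try_decide is invoked whenever a new valid vertex is received. **Lifefin fallback (mode FP).** Each node keeps $r_{fb}$, initially $0$. A node in OP switches to FP when (1) its uncommitted data exceeds a predefined limit, or (2) it has received a PoST block and has not committed DAG vertices for a timeout $T_{st}$. In FP it creates no DAG vertices. On switching, $N_i$ multicasts a PoST block $SB_i$ with fields view $=r_{fb}$,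 vertex $=$ the last (highest-round) vertex created by $N_i$, creator $=N_i$. On receiving $SB_j$, node $N_i$ first checks validity: $N_i$ has the same fallback view; $SB_j$ is the first PoST block from $N_j$ in that view; and $SB_j.\mathit{vertex}$ is either the most recent valid vertex of $N_j$ seen in $DAG_i$ or has a larger round than the last vertex of $N_j$ seen in $DAG_i$. If valid, and if $SB_j.\mathit{vertex}.\mathit{round}-\mathit{currentRound}_i\le 1$ while $N_i$ misses part of the causal history of $SB_j$, then $N_i$ first synchronizes (fetches) the missing history and only then returns the signature $\langle SB_j\rangle_i$; otherwise it returns $\langle SB_j\rangle_i$ immediately. On collecting $2f+1$ signatures (the certificate), $N_i$ calls $\mathit{acs\_propose}_i(SB_i)$. On $\mathit{acs\_decide}_i(V)$ with all views in $V$ equal to $r_{fb}$, $N_i$ does the following (PoST blocks are identified with the vertices they contain). Set $r_{fb}\leftarrow\max\{SB.\mathit{vertex}.\mathit{round}: SB\in V\}$. If $V$ contains the predefined round-$r_{fb}$ leader vertex, let $SB_L$ be it; otherwise choose $SB_L\in V$ with vertex round $r_{fb}$ by a deterministic rule. Set $L_{r_{fb}}\leftarrow SB_L.\mathit{creator}$, so that $SB_L$ replaces the predefined round-$r_{fb}$ leader vertex, and $SB_L$ is marked to-commit. Set the references of the next vertex to be $V$, set the current round to $r_{fb}+2$, call try_decide, and return to OP. *)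

(* Defs.v *)
(* MathComp. *)
From HB Require Import structures.
From mathcomp Require Import all_boot.
From Stdlib Require Relation_Operators.

Set Implicit Arguments.
Unset Strict Implicit.
Unset Printing Implicit Defensive.

Section Data.
Variables (f : nat) (Tx : eqType).

Definition node := 'I_(3 * f).+1.
Definition quorum_size := (2 * f).+1.

(* References are hashes.  A collision-free hash determines the vertex it was
   computed from, so a reference is represented by that vertex itself.  Trees
   containing vertices that nobody created stand for dangling references: such
   a vertex can occur in [refs] but is never held by a correct node. *)
Inductive vertex := Vertex of nat & node & seq vertex & seq Tx.

Definition round v := let: Vertex r _ _ _ := v in r.
Definition creator v := let: Vertex _ i _ _ := v in i.
Definition refs v := let: Vertex _ _ us _ := v in us.
Definition payload v := let: Vertex _ _ _ txs := v in txs.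

Fixpoint vertex_enc (v : vertex) : GenTree.tree (nat * node * seq Tx) :=
  let: Vertex r i us txs := v in
  GenTree.Node 0 (GenTree.Leaf (r, i, txs) :: map vertex_enc us).

Fixpoint vertex_dec (t : GenTree.tree (nat * node * seq Tx)) : option vertex :=
  if t is GenTree.Node _ (GenTree.Leaf (r, i, txs) :: ts)
  then Some (Vertex r i (pmap vertex_dec ts) txs) else None.

Lemma vertex_encK : pcancel vertex_enc vertex_dec.
Proof.
rewrite /pcancel; fix IH 1 => -[r i us txs] /=.
have -> // : pmap vertex_dec (map vertex_enc us) = us.
by elim: us => //= u us; rewrite IH /= => ->.
Qed.

HB.instance Definition _ := Equality.copy vertex (pcan_type vertex_encK).

(* The causal history of a vertex, itself excluded. *)
Fixpoint history (v : vertex) : seq vertex :=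
  let: Vertex _ _ us _ := v in flatten (map (fun u => u :: history u) us).

Definition genesis (i : node) := Vertex 0 i [::] [::].

(* A PoST block. *)
Record post :=
  Post { post_view : nat; post_vertex : vertex; post_creator : node }.

Definition post_enc sb := (post_view sb, post_vertex sb, post_creator sb).
Definition post_dec t := let: (w, v, i) := t in Post w v i.
Lemma post_encK : cancel post_enc post_dec. Proof. by case. Qed.
HB.instance Definition _ := Equality.copy post (can_type post_encK).

Inductive msg :=
| MVertex of vertex
| MPost of post
| MSig of post & node. (* [MSig sb k] is sb signed by k *)

Definition msg_enc m : vertex + post + post * node :=
  match m with
  | MVertex v => inl (inl v)
  | MPost sb => inl (inr sb)
  | MSig sb k => inr (sb, k)
  end.
Definition msg_dec (t : vertex + post + post * node) :=
  match t with
  | inl (inl v) => MVertex v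
  | inl (inr sb) => MPost sb
  | inr (sb, k) => MSig sb k
  end.
Lemma msg_encK : cancel msg_enc msg_dec. Proof. by case. Qed.
HB.instance Definition _ := Equality.copy msg (can_type msg_encK).

Definition signer m :=
  match m with
  | MVertex v => creator v
  | MPost sb => post_creator sb
  | MSig _ k => k
  end.

(* Signatures are returned to the creator of the block; the rest is broadcast. *)
Definition addressed m (i : node) :=
  if m is MSig sb _ then i == post_creator sb else true.

(* The output V of an agreement on common subset: the proposal of each node, at
   most one per node. *)
Definition acs_set := {ffun node -> option post}.

Definition posts_of (V : acs_set) : seq post := pmap V (enum 'I_(3 * f).+1).
Definition fb_round (V : acs_set) := \max_(sb <- posts_of V) round (post_vertex sb).
Definition fb_refs (V : acs_set) := map post_vertex (posts_of V).

Inductive decision := ToCommit of vertex | ToSkip.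

(* The predefined data of a run.  [pick] is the deterministic choice of SB_L
   when V lacks the predefined leader vertex; [linearize v old] orders the
   vertices of the causal history of v (v included) that are not in [old]. *)
Record config := Config {
  leader : nat -> node;
  pick : acs_set -> post;
  linearize : vertex -> seq vertex -> seq vertex;
  vsize : vertex -> nat;
  data_limit : nat;
  stall_timeout : nat;
  capacity : nat;
  delta : nat
}.

Record config_ok (c : config) : Prop := {
  pick_ok : forall V, has (fun sb => round (post_vertex sb) == fb_round V) (posts_of V) ->
    pick c V \in posts_of V /\ round (post_vertex (pick c V)) = fb_round V;
  linearize_ok : forall v old, uniq (linearize c v old) /\
    linearize c v old =i [pred u | (u \in v :: history v) && (u \notin old)]
}.

Inductive mode := OP | FP.

Record lstate := LState {
  lmode : mode;
  view : nat;                     (* r_fb *)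
  current : nat;
  last_vertex : vertex;           (* the last vertex created by the node *)
  dag : seq vertex;               (* all held vertices; DAG_i[r] are those of round r *)
  fallbacks : seq acs_set;         (* the sets V acted upon so far *)
  buffer : seq msg;               (* arrived and not yet processed *)
  arrived : seq msg;
  posts : seq post;               (* PoST blocks received *)
  to_sign : seq post;             (* valid, to be signed after synchronization *)
  sigs : seq (post * node);       (* signatures received *)
  proposal : nat -> option post;  (* acs_propose, by fallback view *)
  output : nat -> option acs_set;  (* acs_decide, by fallback view *)
  committed : nat;                (* committedRound *)
  ordered : seq vertex;
  last_commit : nat               (* time of the last commit *)
}.

(* In the updates below, the pattern variables follow the order of the fields. *)
Definition set_mode x l := let: LState m w c v d F b a p q s P y k o t := l in
  LState x w c v d F b a p q s P y k o t.
Definition set_buffer x l := let: LState m w c v d F b a p q s P y k o t := l in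
  LState m w c v d F x a p q s P y k o t.
Definition set_arrived x l := let: LState m w c v d F b a p q s P y k o t := l in
  LState m w c v d F b x p q s P y k o t.
Definition set_dag x l := let: LState m w c v d F b a p q s P y k o t := l in
  LState m w c v x F b a p q s P y k o t.
Definition set_posts x l := let: LState m w c v d F b a p q s P y k o t := l in
  LState m w c v d F b a x q s P y k o t.
Definition set_to_sign x l := let: LState m w c v d F b a p q s P y k o t := l in
  LState m w c v d F b a p x s P y k o t.
Definition set_sigs x l := let: LState m w c v d F b a p q s P y k o t := l in
  LState m w c v d F b a p q x P y k o t.
Definition set_proposal x l := let: LState m w c v d F b a p q s P y k o t := l in
  LState m w c v d F b a p q s x y k o t.
Definition set_output x l := let: LState m w c v d F b a p q s P y k o t := l in
  LState m w c v d F b a p q s P x k o t.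
(* Entering a round and creating the vertex x of that round are one action. *)
Definition set_last x l := let: LState m w c v d F b a p q s P y k o t := l in
  LState m w (round x) x (x :: d) F b a p q s P y k o t.
Definition set_fallback V l := let: LState m w c v d F b a p q s P y k o t := l in
  LState m (fb_round V) (fb_round V).+2 v d (V :: F) b a p q s P y k o t.
Definition set_final k' o' t' l := let: LState m w c v d F b a p q s P y k o t := l in
  LState m w c v d F b a p q s P y k' o' t'.

Record gstate := GState {
  now : nat;
  net : seq (node * msg);         (* everything sent so far, with its sender *)
  loc : node -> lstate            (* meaningful for correct nodes only *)
}.

Definition fset_at (T : Type) (g : nat -> option T) w x : nat -> option T :=
  fun w' => if w' == w then Some x else g w'.

End Data.

Section Protocol.
Variables (f : nat) (Tx : eqType) (c : config f Tx) (byz : {set node f}).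
Local Notation node := (node f).
Local Notation vertex := (vertex f Tx).
Local Notation post := (post f Tx).
Local Notation msg := (msg f Tx).
Local Notation acs_set := (acs_set f Tx).
Local Notation lstate := (lstate f Tx).
Local Notation gstate := (gstate f Tx).
Implicit Types (l : lstate) (g : gstate) (v u a : vertex) (sb : post) (V : acs_set).

(** Leaders *)

Definition fb_leader V : post :=
  head (pick c V)
    [seq sb <- posts_of V | (round (post_vertex sb) == fb_round V)
                         && (creator (post_vertex sb) == leader c (fb_round V))].

Definition fb_leader_at l r : option vertex :=
  ohead [seq post_vertex (fb_leader V) | V <- fallbacks l & fb_round V == r].

(* A Byzantine leader may have several leader vertices for the same round. *)
Definition leader_vertex l r v : bool :=
  if fb_leader_at l r is Some u then v == u
  else (round v == r) && (creator v == leader c r).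

(** Patterns and decision rules *)

Definition quorum (Q : seq vertex) : bool :=
  uniq (map (@creator f Tx) Q) && (quorum_size f <= size Q).

Definition skip_pattern v (Q : seq vertex) : bool :=
  quorum Q && all (fun u => (round u == (round v).+1) && (v \notin refs u)) Q.

Definition certificate_pattern v (Q : seq vertex) : bool :=
  quorum Q && all (fun u => (round u == (round v).+1) && (v \in refs u)) Q.

Definition holds_history l v : Prop := {subset history v <= dag l}.

(* u is a certificate for v, as seen by a node in state l: the pattern has to be
   held, a mere reference to it being unverifiable. *)
Definition certificate l u v : Prop :=
  (round v).+1 < round u /\
  exists Q, [/\ certificate_pattern v Q, {subset Q <= history u} & {subset Q <= dag l}].

(* With an equivocating leader, to-skip requires a skip pattern for each possible
   leader vertex: when one of two such vertices is certified, the certificate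
   pattern is a skip pattern for the other one. *)
Inductive direct l r : decision f Tx -> Prop :=
| direct_commit v C :
    leader_vertex l r v -> quorum C -> {subset C <= dag l} ->
    (forall u, u \in C -> round u = r.+2 /\ certificate l u v) ->
    direct l r (ToCommit v)
| direct_skip :
    (forall v, leader_vertex l r v -> exists2 Q, skip_pattern v Q & {subset Q <= dag l}) ->
    direct l r (ToSkip f Tx).

(* The leader rounds that get no mark are the undecided ones.  Hence in the
   indirect rules r' is the first round > r+2 marked to-commit or undecided, and
   it is marked to-commit.  The causal history of its leader vertex has to be
   held, for the absence of a certificate pattern to be known. *)
Inductive marked l : nat -> decision f Tx -> Prop :=
| marked_fallback r v :
    fb_leader_at l r = Some v -> marked l r (ToCommit v)
| marked_direct r d :
    fb_leader_at l r = None -> direct l r d -> marked l r d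
| marked_indirect_commit r r' a v :
    fb_leader_at l r = None -> ~ (exists d, direct l r d) ->
    r.+2 < r' <= current l ->
    (forall q, r.+2 < q < r' -> marked l q (ToSkip f Tx)) ->
    marked l r' (ToCommit a) -> a \in dag l -> holds_history l a ->
    leader_vertex l r v -> certificate l a v ->
    marked l r (ToCommit v)
| marked_indirect_skip r r' a :
    fb_leader_at l r = None -> ~ (exists d, direct l r d) ->
    r.+2 < r' <= current l ->
    (forall q, r.+2 < q < r' -> marked l q (ToSkip f Tx)) ->
    marked l r' (ToCommit a) -> a \in dag l -> holds_history l a ->
    ~ (exists2 v, leader_vertex l r v & certificate l a v) ->
    marked l r (ToSkip f Tx).

(* Ordering a leader vertex requires its causal history to be held. *)
Inductive finalize_next (t : nat) l : lstate -> Prop :=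
| finalize_commit v :
    committed l < current l -> marked l (committed l).+1 (ToCommit v) ->
    v \in dag l -> holds_history l v ->
    finalize_next t l
      (set_final (committed l).+1 (ordered l ++ linearize c v (ordered l)) t l)
| finalize_skip :
    committed l < current l -> marked l (committed l).+1 (ToSkip f Tx) ->
    finalize_next t l (set_final (committed l).+1 (ordered l) (last_commit l) l).

Definition try_decide t l l' : Prop :=
  Relation_Operators.clos_refl_trans _ (finalize_next t) l l' /\ ~ (exists l'', finalize_next t l' l'').

(** Vertices *)

Definition regular_refs v : bool :=
  quorum (refs v) && all (fun u => (round u).+1 == round v) (refs v).

Definition valid_vertex l v : bool :=
  regular_refs v ||
  has (fun V => (round v == (fb_round V).+2) && perm_eq (refs v) (fb_refs V)) (fallbacks l).

Definition create t v l l' : Prop := try_decide t (set_last v l) l'.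

Definition has_room l : bool := size (buffer l) < capacity c.

(* The missing vertices a node may ask for. *)
Definition wanted l v : Prop :=
  v \notin dag l /\
  [\/ exists2 u, u \in dag l & v \in history u,
      exists2 sb, sb \in posts l & v \in post_vertex sb :: history (post_vertex sb)
    | exists V u, [/\ V \in fallbacks l, u \in fb_refs V & v \in u :: history u]].

(** PoST blocks *)

Definition own_post (i : node) l := Post (view l) (last_vertex l) i.

Definition uncommitted_data l :=
  \sum_(v <- dag l | v \notin ordered l) vsize c v.

Definition valid_post l sb : bool :=
  let v := post_vertex sb in
  let mine := [seq u <- dag l | creator u == post_creator sb] in
  [&& post_view sb == view l,
      ~~ has (fun sb' => (post_creator sb' == post_creator sb) && (post_view sb' == view l))
             (posts l),
      creator v == post_creator sb
    & (v \in mine) && all (fun u => round u <= round v) mine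
      || all (fun u => round u < round v) mine].

(** Steps of a correct node i at time t, with the messages it sends *)

(* A node enters a round by creating its vertex of that round; a node that lacks
   the resources for a new vertex stays in its round.  After a fallback, the
   vertex referencing V is created on return to OP, so that the next fallback, if
   any, proposes it or a later one.  Nodes act on a decided V in either mode. *)

Inductive lstep (i : node) (t : nat) l : lstate -> seq msg -> Prop :=
| step_enter_round v Q l' :
    lmode l = OP -> has_room l ->
    quorum Q -> {subset Q <= dag l} -> all (fun u => round u == current l) Q ->
    round v = (current l).+1 -> creator v = i ->
    regular_refs v -> {subset refs v <= dag l} ->
    (forall u, u \in refs v -> leader_vertex l (current l) u -> holds_history l u) ->
    create t v l l' ->
    lstep i t l l' [:: MVertex v]
| step_receive_vertex v l' :
    MVertex v \in buffer l -> v \notin dag l -> valid_vertex l v ->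
    try_decide t (set_dag (v :: dag l) (set_buffer (rem (MVertex v) (buffer l)) l)) l' ->
    lstep i t l l' [::]
| step_discard_vertex v :
    MVertex v \in buffer l -> (v \in dag l) || ~~ valid_vertex l v ->
    lstep i t l (set_buffer (rem (MVertex v) (buffer l)) l) [::]
| step_fall_back :
    lmode l = OP ->
    data_limit c < uncommitted_data l \/
      (posts l != [::] /\ last_commit l + stall_timeout c <= t) ->
    lstep i t l (set_mode FP l) [:: MPost (own_post i l)]
| step_receive_post sb :
    MPost sb \in buffer l ->
    let l1 := set_posts (sb :: posts l) (set_buffer (rem (MPost sb) (buffer l)) l) in
    valid_post l sb ->
    (current l).+1 < round (post_vertex sb) \/ holds_history l (post_vertex sb) ->
    lstep i t l l1 [:: MSig sb i]
| step_receive_post_sync sb :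
    MPost sb \in buffer l ->
    let l1 := set_posts (sb :: posts l) (set_buffer (rem (MPost sb) (buffer l)) l) in
    valid_post l sb ->
    round (post_vertex sb) <= (current l).+1 -> ~ holds_history l (post_vertex sb) ->
    lstep i t l (set_to_sign (sb :: to_sign l) l1) [::]
| step_receive_post_invalid sb :
    MPost sb \in buffer l ->
    let l1 := set_posts (sb :: posts l) (set_buffer (rem (MPost sb) (buffer l)) l) in
    ~~ valid_post l sb ->
    lstep i t l l1 [::]
| step_sign_after_sync sb :
    sb \in to_sign l -> holds_history l (post_vertex sb) ->
    lstep i t l (set_to_sign (rem sb (to_sign l)) l) [:: MSig sb i]
| step_receive_sig sb k :
    MSig sb k \in buffer l ->
    lstep i t l
      (set_sigs ((sb, k) :: sigs l) (set_buffer (rem (MSig sb k) (buffer l)) l)) [::]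
| step_propose (S : {set node}) :
    lmode l = FP -> proposal l (view l) = None ->
    quorum_size f <= #|S| -> (forall k, k \in S -> (own_post i l, k) \in sigs l) ->
    lstep i t l (set_proposal (fset_at (proposal l) (view l) (own_post i l)) l) [::]
| step_acs_decide w V :
    output l w = None ->
    lstep i t l (set_output (fset_at (output l) w V) l) [::]
| step_return V txs l1 l' :
    output l (view l) = Some V -> all (fun sb => post_view sb == view l) (posts_of V) ->
    try_decide t (set_fallback V l) l1 ->
    let v := Vertex (fb_round V).+2 i (fb_refs V) txs in
    create t v (set_mode OP l1) l' ->
    lstep i t l l' [:: MVertex v].

(** The system *)

(* Signatures are unforgeable: the adversary can only make up messages signed by
   Byzantine nodes, or relay the messages of correct ones. *)
Definition authentic g m : Prop := signer m \in byz \/ (signer m, m) \in net g.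

Definition set_loc g (i : node) l : node -> lstate :=
  fun j => if j == i then l else loc g j.

Inductive step g : gstate -> Prop :=
| step_local i l' out :
    i \notin byz -> lstep i (now g) (loc g i) l' out ->
    step g (GState (now g) ([seq (i, m) | m <- out] ++ net g) (set_loc g i l'))
| step_fetch i v l' :
    i \notin byz -> wanted (loc g i) v -> authentic g (MVertex v) ->
    valid_vertex (loc g i) v ->
    try_decide (now g) (set_dag (v :: dag (loc g i)) (loc g i)) l' ->
    step g (GState (now g) (net g) (set_loc g i l'))
| step_arrive i s m :
    i \notin byz -> (s, m) \in net g -> addressed m i ->
    let l := loc g i in
    let l1 := set_arrived (m :: arrived l) l in
    step g (GState (now g) (net g)
      (set_loc g i (if has_room l then set_buffer (rcons (buffer l) m) l1 else l1)))
| step_byzantine b m :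
    b \in byz -> authentic g m ->
    step g (GState (now g) ((b, m) :: net g) (loc g))
| step_time :
    step g (GState (now g).+1 (net g) (loc g)).

Definition genesis_dag : seq vertex := [seq genesis Tx i | i <- enum 'I_(3 * f).+1].

Definition init_lstate v : lstate :=
  LState OP 0 1 v (v :: genesis_dag) [::] [::] [::] [::] [::] [::]
    (fun=> None) (fun=> None) 0 [::] 0.

Definition init g : Prop :=
  exists v1 : node -> vertex,
    [/\ forall i, i \notin byz ->
          [/\ round (v1 i) = 1, creator (v1 i) = i, regular_refs (v1 i),
              {subset refs (v1 i) <= genesis_dag} & loc g i = init_lstate (v1 i)],
        net g = [seq (i, MVertex (v1 i)) | i <- enum (~: byz)]
      & now g = 0].

Record execution (e : nat -> gstate) : Prop := {
  execution_init : init (e 0);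
  execution_step : forall k, step (e k) (e k.+1)
}.

(* The agreement on common subset is a black box; its instances are indexed by
   the fallback view.  The proposals of Byzantine nodes are arbitrary. *)
Record acs_spec (e : nat -> gstate) : Prop := {
  acs_validity : forall k w i V, i \notin byz -> output (loc (e k) i) w = Some V ->
    [/\ (3 * f).+1 - f <= #|[set j | V j]|,
        (3 * f).+1 - 2 * f
          <= #|[set j | [&& j \notin byz, V j & V j == proposal (loc (e k) j) w]]|
      & forall j sb, j \notin byz -> V j = Some sb -> proposal (loc (e k) j) w = Some sb];
  acs_agreement : forall k w i V, i \notin byz -> output (loc (e k) i) w = Some V ->
    forall j, j \notin byz -> exists k', output (loc (e k') j) w = Some V;
  acs_termination : forall w,
    (forall i, i \notin byz -> exists k, proposal (loc (e k) i) w : bool) ->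
    forall i, i \notin byz -> exists k, output (loc (e k) i) w : bool
}.

Definition partially_synchronous (e : nat -> gstate) : Prop :=
  exists GST, forall k s m, s \notin byz ->
    (s, m) \notin net (e k) -> (s, m) \in net (e k.+1) -> GST <= now (e k) ->
    forall i, i \notin byz -> addressed m i ->
    exists2 k', now (e k') <= now (e k) + delta c & m \in arrived (loc (e k') i).

(** Ledgers *)

Definition ledger g (i : node) : seq Tx :=
  flatten (map (@payload f Tx) (ordered (loc g i))).

End Protocol.

(* A transaction submitted to several nodes may occur several times in a ledger;
   it is delivered at its first occurrence.  Since [index] is the size of the
   ledger for an absent transaction, tx' may be still undelivered here. *)
Definition delivers_before (Tx : eqType) (L : seq Tx) (tx tx' : Tx) : bool :=
  index tx L < index tx' L.

(* Main.v *)
(* Two sets of 2f+1 nodes share a correct node, and a correct node creates at most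
   one vertex per round, so a certificate pattern for a vertex excludes a skip
   pattern for it and a certificate pattern for an equivocating one.

   Fallbacks do not interfere because of a gap: if V is the output of a view and R
   its maximal round, any quorum of vertices of round R+1 would contain one of a
   correct node proposing in V, whose vertices before its proposal have round at
   most R and whose later ones have round at least R+2.  Hence nobody is beyond
   round R+1 before acting on V, a node that has not acted on V never decides round
   R, and no vertex of round R-1 is directly committed.  A vertex of round R-2
   directly committed anywhere has one of its certificates among the vertices of V.

   It follows that a vertex directly committed at one node has a certificate pattern
   in the history of any later leader vertex on which another node bases an indirect
   decision.  By induction from the higher rounds to the lower ones, any two marks
   put on a round, at any two nodes and times, coincide; the ledgers are obtained by
   folding these marks in increasing round order. *)
Require Import Defs.
From mathcomp Require Import all_boot.
From mathcomp Require Import zify.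

Set Implicit Arguments.
Unset Strict Implicit.
Unset Printing Implicit Defensive.

(** * Quorum intersection and the shape of ACS outputs *)

Section Quorums.
Variables (f : nat) (Tx : eqType) (byz : {set node f}).
Hypothesis byz_le : #|byz| <= f.
Implicit Types (Q : seq (vertex f Tx)) (V : acs_set f Tx).

(** The sizes add up to at least [4f + 2] among [3f + 1] nodes, so at least [f + 1] nodes are
    shared, more than can be Byzantine. *)
Lemma large_sets_meet (A B : {set node f}) :
  quorum_size f <= #|A| -> quorum_size f <= #|B| ->
  exists i, [/\ i \in A, i \in B & i \notin byz].
Proof.
rewrite /quorum_size => cA cB.
have [/subset_leq_card le_byz | /subsetPn[i /setIP[iA iB] iN]] :=
  boolP (A :&: B \subset byz); last by exists i.
have le_U : #|A :|: B| <= (3 * f).+1 by rewrite -[X in _ <= X]card_ord max_card.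
have le_I := leq_trans le_byz byz_le.
have := leq_trans (leq_add cA cB) _; rewrite -cardsUI => /(_ _ (leq_add le_U le_I)).
by lia.
Qed.

Lemma card_quorum_creators Q :
  quorum Q -> quorum_size f <= #|[set i in map (@creator f Tx) Q]|.
Proof. by case/andP=> uQ; rewrite cardsE (card_uniqP uQ) size_map. Qed.

Lemma quorums_meet Q Q' : quorum Q -> quorum Q' ->
  exists x y, [/\ x \in Q, y \in Q', creator x = creator y & creator x \notin byz].
Proof.
move=> /card_quorum_creators qQ /card_quorum_creators qQ'.
have [i []] := large_sets_meet qQ qQ'.
rewrite !inE => /mapP[x xQ ->] /mapP[y yQ' eq_xy] xN.
by exists x, y.
Qed.

Lemma quorum_meets_acs Q V : quorum Q -> quorum_size f <= #|[set j | V j]| ->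
  exists x sb, [/\ x \in Q, creator x \notin byz & V (creator x) = Some sb].
Proof.
move=> /card_quorum_creators qQ qV.
have [i []] := large_sets_meet qQ qV.
rewrite !inE => /mapP[x xQ ->] Vx xN.
by case E: (V (creator x)) Vx => [sb|] // _; exists x, sb.
Qed.

Lemma quorum_inhabited Q : quorum Q -> exists x, x \in Q.
Proof. by case: Q => [|x Q] // _; exists x; rewrite mem_head. Qed.

Lemma mem_posts_of V i sb : V i = Some sb -> sb \in posts_of V.
Proof. by move=> Vi; rewrite /posts_of mem_pmap -Vi map_f ?mem_enum. Qed.

Lemma round_le_fb_round V sb : sb \in posts_of V -> round (post_vertex sb) <= fb_round V.
Proof. by move=> sbV; rewrite /fb_round; apply: leq_bigmax_seq. Qed.

Lemma round_fb_refs V x : x \in fb_refs V -> round x <= fb_round V.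
Proof. by case/mapP=> sb sbV ->; apply: round_le_fb_round. Qed.

(** Positivity rules out the empty [V], whose maximum is [0] by convention. *)
Lemma fb_round_attained V : 0 < fb_round V ->
  has (fun sb => round (post_vertex sb) == fb_round V) (posts_of V).
Proof.
rewrite /fb_round; elim: (posts_of V) => [|sb s IHs]; first by rewrite big_nil.
rewrite big_cons /= => _.
have [le_s | lt_s] := leqP (\max_(j <- s) round (post_vertex j)) (round (post_vertex sb)).
  by rewrite eqxx.
by rewrite IHs ?orbT //; apply: leq_ltn_trans lt_s.
Qed.

Lemma mem_history (v : vertex f Tx) u : u \in refs v -> {subset u :: history u <= history v}.
Proof.
case: v => r i us txs /= uv x xu; apply/flattenP; exists (u :: history u) => //.
by apply/mapP; exists u.
Qed.

Lemma round_fb_leader (c : config f Tx) V : config_ok c -> 0 < fb_round V ->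
  round (post_vertex (fb_leader c V)) = fb_round V.
Proof.
move=> c_ok /fb_round_attained /(pick_ok c_ok)[_ pickV].
rewrite /fb_leader; set s := filter _ _.
have: all (fun sb => round (post_vertex sb) == fb_round V) s.
  by apply/allP=> sb; rewrite mem_filter => /andP[/andP[]].
by case: s => [|sb s] //= /andP[/eqP].
Qed.

End Quorums.

(** * Abstract facts about a run, and sound states *)

Section Agreement.
Variables (f : nat) (Tx : eqType) (c : config f Tx) (byz : {set node f}).
Variables (E : vertex f Tx -> Prop) (O : nat -> acs_set f Tx -> Prop).
Implicit Types (x y u v a : vertex f Tx) (Q : seq (vertex f Tx)) (V : acs_set f Tx).
Implicit Types (l : lstate f Tx).

(** Genesis vertices are held without ever having been sent, hence the restriction to positive
    rounds. *)
Definition correct_created Q :=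
  forall x, x \in Q -> 0 < round x -> creator x \notin byz -> E x.

(* [E x]: x is created by its creator at some time of the run; [O w V]: V is the
   ACS output of fallback view w. *)
Record run_facts : Prop := {
  created_uniq : forall x y, E x -> E y -> creator x = creator y ->
    creator x \notin byz -> round x = round y -> x = y;
  output_fun : forall w V V', O w V -> O w V' -> V = V';
  output_increasing : forall w V, O w V -> w < fb_round V;
  no_quorum_after_output : forall w V Q, O w V -> quorum Q -> correct_created Q ->
    ~ (forall x, x \in Q -> round x = (fb_round V).+1);
  quorum_meets_output : forall w V Q, O w V -> quorum Q -> correct_created Q ->
    (forall x, x \in Q -> round x = fb_round V) -> exists2 x, x \in Q & x \in fb_refs V
}.

(* The fallbacks a node went through, latest first, and the view it reached. *)
Inductive chain : nat -> seq (acs_set f Tx) -> Prop :=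
| chain_nil : chain 0 [::]
| chain_cons w F V : chain w F -> O w V -> chain (fb_round V) (V :: F).

(** [sound_quorum] starts at round [view l + 2], the round to which a return to OP jumps; leaving
    that round or a later one takes a quorum of its vertices. *)
Record sound l : Prop := {
  sound_created : correct_created (dag l);
  sound_valid : forall x, x \in dag l -> 0 < round x -> valid_vertex l x;
  sound_chain : chain (view l) (fallbacks l);
  sound_quorum : forall r, (view l).+1 < r < current l ->
    exists Q, [/\ quorum Q, {subset Q <= dag l} & forall x, x \in Q -> round x = r]
}.

Hypothesis c_ok : config_ok c.
Hypothesis byz_le : #|byz| <= f.
Hypothesis facts : run_facts.

Lemma sub_created Q Q' :
  {subset Q <= Q'} -> correct_created Q' -> correct_created Q.
Proof. by move=> sQQ' cQ' x /sQQ'; apply: cQ'. Qed.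

(** * Chains of fallbacks *)

Lemma chain_mem w F V : chain w F -> V \in F -> fb_round V <= w /\ exists w', O w' V.
Proof.
elim=> {w F} // w F V' _ IH OV'; rewrite inE => /predU1P[-> | /IH[le_w ?]].
  by split=> //; exists w.
by split=> //; apply: leq_trans le_w (ltnW (output_increasing facts OV')).
Qed.

(** Each output has a round above the view it settles, and that view is the round of the previous
    fallback, so rounds strictly increase along a chain. *)
Lemma chain_fb_round_inj w F V V' : chain w F -> V \in F -> V' \in F ->
  fb_round V = fb_round V' -> V = V'.
Proof.
move=> chF; elim: chF V V' => {w F} // w F V0 chF IH OV0 V V'.
have lt0 V1 : V1 \in F -> fb_round V1 < fb_round V0.
  move=> /(chain_mem chF)[le_w _]; exact: leq_ltn_trans le_w (output_increasing facts OV0).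
rewrite !inE => /predU1P[-> | VF] /predU1P[-> | V'F] // eqV; last exact: IH.
- by have := lt0 _ V'F; rewrite -eqV ltnn.
- by have := lt0 _ VF; rewrite eqV ltnn.
Qed.

Lemma chain_nth w F n V0 : chain w F -> n < size F ->
  exists w', chain w' (drop n.+1 F) /\ O w' (nth V0 F n).
Proof.
move=> chF; elim: chF n => {w F} // w F V chF IH OV [|n] /=; last exact: IH.
by rewrite drop0; exists w.
Qed.

(** A view fixes its output by [output_fun], and the output fixes the next view, so only the length
    of a chain is free. *)
Lemma chain_size_inj w F w' F' : chain w F -> chain w' F' -> size F = size F' ->
  w = w' /\ F = F'.
Proof.
move=> chF; elim: chF w' F' => {w F} [|w F V _ IH OV] _ _ [|w' F' V' chF' OV'] //= [eqs].
have [eqw eqF] := IH _ _ chF' eqs.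
by rewrite -eqw in OV'; rewrite eqF (output_fun facts OV OV').
Qed.

(** Both chains follow the same sequence of fallbacks and [F] stops before [V]; the witness [V1] is
    the first fallback that [F] lacks. *)
Lemma chain_behind w F w' F' V : chain w F -> chain w' F' -> V \in F' -> V \notin F ->
  exists2 V1, O w V1 & fb_round V1 <= fb_round V.
Proof.
move=> chF chF' VF' VNF.
have ltn' : index V F' < size F' by rewrite index_mem.
have [w0 [ch0]] := chain_nth V chF' ltn'; rewrite nth_index // => OV.
have [lt_s|lt_s|eq_s] := ltngtP (size (drop (index V F').+1 F')) (size F).
(* This is the index at which [F] has as many older entries as [V] has in [F']; the entry found
   there must be [V]. *)
- have ltn : size F - (size (drop (index V F').+1 F')).+1 < size F by lia.
  have [w1 [ch1 OV1]] := chain_nth V chF ltn.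
  have [|eqw _] := chain_size_inj ch0 ch1; first by rewrite [RHS]size_drop; lia.
  rewrite -eqw in OV1; case/negP: VNF.
  by rewrite (output_fun facts OV OV1) mem_nth.
(* Here [F] is an older part of what precedes [V] in [F'], and [V1] is the entry of [F0] right after
   that part. *)
- set F0 := drop _ _ in ch0 lt_s.
  have ltn : size F0 - (size F).+1 < size F0 by lia.
  have [w1 [ch1 OV1]] := chain_nth V ch0 ltn.
  have [|eqw _] := chain_size_inj chF ch1; first by rewrite size_drop; lia.
  exists (nth V F0 (size F0 - (size F).+1)); first by rewrite eqw.
  have [le_w _] := chain_mem ch0 (mem_nth V ltn).
  exact: leq_trans le_w (ltnW (output_increasing facts OV)).
- have [eqw _] := chain_size_inj ch0 chF eq_s.
  by exists V; rewrite // -eqw.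
Qed.

(** Let [V1] be the output of the view in which the node still is. Being any further, the node would
    have left round [fb_round V1 + 1], hence hold a quorum of that round, which cannot exist. *)
Lemma current_behind l w' F' V : sound l -> chain w' F' -> V \in F' ->
  V \notin fallbacks l -> current l <= (fb_round V).+1.
Proof.
move=> sl chF' VF' VN; have [V1 OV1 le1] := chain_behind (sound_chain sl) chF' VF' VN.
rewrite leqNgt; apply/negP=> lt_c.
have [|Q [qQ sQ rQ]] := sound_quorum sl (r := (fb_round V1).+1).
  by rewrite ltnS (output_increasing facts OV1) /=; lia.
exact: (no_quorum_after_output facts OV1 qQ (sub_created sQ (sound_created sl))) rQ.
Qed.

(** * Fallback leaders *)

Lemma fb_leader_at_Some l r v : fb_leader_at c l r = Some v ->
  exists V, [/\ V \in fallbacks l, fb_round V = r & v = post_vertex (fb_leader c V)].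
Proof.
rewrite /fb_leader_at; set s := filter _ _ => eqv.
have: all (fun V => (V \in fallbacks l) && (fb_round V == r)) s.
  by apply/allP=> V; rewrite mem_filter andbC.
by case: s eqv => [|V s] //= [<-] /andP[/andP[VF /eqP eqr] _]; exists V.
Qed.

Lemma fb_leader_at_None l V : fb_leader_at c l (fb_round V) = None -> V \notin fallbacks l.
Proof.
rewrite /fb_leader_at; case eqs: filter => [|//] _; apply/negP=> VF.
suff: V \in [::] by [].
by rewrite -eqs mem_filter eqxx.
Qed.

Lemma fb_leader_at_agree l l' r v v' : sound l -> sound l' ->
  fb_leader_at c l r = Some v -> fb_leader_at c l' r = Some v' -> v = v'.
Proof.
move=> sl sl' /fb_leader_at_Some[V [VF rV ->]] /fb_leader_at_Some[V' [VF' rV' ->]].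
suff -> : V = V' by [].
have same l1 V1 V2 : sound l1 -> V1 \in fallbacks l1 -> V2 \in fallbacks l1 ->
    fb_round V1 = fb_round V2 -> V1 = V2.
  by move=> sl1; apply: chain_fb_round_inj (sound_chain sl1).
have [VF2 | VN] := boolP (V \in fallbacks l').
  by apply: same sl' VF2 VF' _; rewrite rV.
have [VF2 | VN'] := boolP (V' \in fallbacks l).
  by apply: same sl VF VF2 _; rewrite rV.
(* Neither node acted on the other's set: the output of the view of [l'] then has round at most [r],
   although this view is already at least [fb_round V' = r]. *)
have [V1 OV1 le1] := chain_behind (sound_chain sl') (sound_chain sl) VF VN.
have [le_w _] := chain_mem (sound_chain sl') VF'.
have := output_increasing facts OV1; lia.
Qed.

(** * Leader vertices, skip patterns and certificate patterns *)

Lemma leader_vertex_default l r v : fb_leader_at c l r = None ->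
  leader_vertex c l r v = (round v == r) && (creator v == leader c r).
Proof. by rewrite /leader_vertex => ->. Qed.

Lemma round_leader_vertex l r v : sound l -> leader_vertex c l r v -> round v = r.
Proof.
move=> sl; rewrite /leader_vertex; case eqf: fb_leader_at => [u|]; last by case/andP=> /eqP.
have [V [VF <- ->] /eqP ->] := fb_leader_at_Some eqf.
have [_ [w OV]] := chain_mem (sound_chain sl) VF.
by rewrite round_fb_leader // (leq_ltn_trans _ (output_increasing facts OV)).
Qed.

Lemma marked_leader_vertex l r v : marked c l r (ToCommit v) -> leader_vertex c l r v.
Proof.
move=> mk; move eq_d: (ToCommit v) mk => d mk.
case: mk eq_d => {r d} [r u | r d fbN | |//] //.
- by rewrite /leader_vertex => -> [->].
- by case=> // u C lu _ _ _ [->].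
- by move=> r r' a u _ _ _ _ _ _ _ lu _ [->].
Qed.

(** A round of the form [r.+1] keeps genesis vertices out, so the shared correct node did create
    both of its vertices, and it creates only one per round. *)
Lemma common_vertex l l' Q Q' r : sound l -> sound l' -> quorum Q -> quorum Q' ->
  {subset Q <= dag l} -> {subset Q' <= dag l'} ->
  (forall x, x \in Q -> round x = r.+1) -> (forall x, x \in Q' -> round x = r.+1) ->
  exists2 x, x \in Q & x \in Q'.
Proof.
move=> sl sl' qQ qQ' sQ sQ' rQ rQ'.
have [x [y [xQ yQ' eq_c xN]]] := quorums_meet byz_le qQ qQ'.
exists x => //; suff -> : x = y by [].
apply: (created_uniq facts) => //; last by rewrite rQ ?rQ'.
- by apply: (sound_created sl) => //; [apply: sQ | rewrite rQ].
- by apply: (sound_created sl'); [apply: sQ' | rewrite rQ' | rewrite -eq_c].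
Qed.

Lemma round_skip_pattern v Q x : skip_pattern v Q -> x \in Q -> round x = (round v).+1.
Proof. by case/andP=> _ /allP sk /sk /andP[/eqP]. Qed.

Lemma round_certificate_pattern v Q x :
  certificate_pattern v Q -> x \in Q -> round x = (round v).+1.
Proof. by case/andP=> _ /allP sk /sk /andP[/eqP]. Qed.

Lemma skipped_not_certified l l' v Q Q' : sound l -> sound l' ->
  skip_pattern v Q -> {subset Q <= dag l} ->
  certificate_pattern v Q' -> {subset Q' <= dag l'} -> False.
Proof.
move=> sl sl' skQ sQ ceQ' sQ'.
have rQ := round_skip_pattern skQ; have rQ' := round_certificate_pattern ceQ'.
case/andP: skQ => qQ /allP skQ; case/andP: ceQ' => qQ' /allP ceQ'.
have [x /skQ/andP[_ vNx] /ceQ'/andP[_ vx]] := common_vertex sl sl' qQ qQ' sQ sQ' (@rQ) (@rQ').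
by rewrite vx in vNx.
Qed.

Lemma creator_inj_in Q x y : uniq (map (@creator f Tx) Q) -> x \in Q -> y \in Q ->
  creator x = creator y -> x = y.
Proof.
elim: Q => //= z Q IHQ /andP[zN uQ]; rewrite !inE => /predU1P[->|xQ] /predU1P[->|yQ] // eq_c.
- by rewrite eq_c map_f in zN.
- by rewrite -eq_c map_f in zN.
- exact: IHQ.
Qed.

(** The two patterns share a vertex [x] referencing both [v] and [v']. References of a regular
    vertex have distinct creators, while those of a vertex created after a fallback lie at least two
    rounds below it, too low for [v]. *)
Lemma certified_leader_uniq l l' r v v' Q Q' : sound l -> sound l' ->
  fb_leader_at c l r = None -> fb_leader_at c l' r = None ->
  leader_vertex c l r v -> leader_vertex c l' r v' ->
  certificate_pattern v Q -> {subset Q <= dag l} ->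
  certificate_pattern v' Q' -> {subset Q' <= dag l'} -> v = v'.
Proof.
move=> sl sl' fbN fbN' lv lv' ceQ sQ ceQ' sQ'.
have rQ := round_certificate_pattern ceQ; have rQ' := round_certificate_pattern ceQ'.
move: lv lv'; rewrite !leader_vertex_default // => /andP[/eqP rv /eqP cv] /andP[/eqP rv' /eqP cv'].
case/andP: ceQ => qQ /allP ceQ; case/andP: ceQ' => qQ' /allP ceQ'.
rewrite rv in rQ; rewrite rv' in rQ'.
have [x xQ xQ'] := common_vertex sl sl' qQ qQ' sQ sQ' (@rQ) (@rQ').
have /andP[/eqP rx vx] := ceQ _ xQ; have /andP[_ v'x] := ceQ' _ xQ'.
have /orP[/andP[/andP[ux _] _]|/hasP[V VF /andP[/eqP rV /perm_mem eqr]]] :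
    valid_vertex l x by apply: (sound_valid sl); [apply: sQ | rewrite rx].
  by apply: creator_inj_in ux vx v'x _; rewrite cv cv'.
have := vx; rewrite eqr => /round_fb_refs; lia.
Qed.

(* Descending from x, either a layer of round [round v + 2] is reached, which meets
   the quorum of certificates C, or a fallback layer whose references come from a
   set V of maximal round [round v + 2], which meets C as well. *)
Lemma certificate_in_history l l' v C r x : sound l -> sound l' ->
  quorum C -> {subset C <= dag l} ->
  (forall u, u \in C -> round u = (round v).+2 /\ certificate l u v) ->
  (forall V, V \in fallbacks l' -> ~~ ((round v).+2 < fb_round V < r)) ->
  (round v).+2 < round x <= r -> x \in dag l' -> holds_history l' x ->
  exists2 Q, certificate_pattern v Q & {subset Q <= history x}.
Proof.
move=> sl sl' qC sC ceC noF.
have rC u : u \in C -> round u = (round v).+2 by case/ceC.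
have crC : correct_created C := sub_created sC (sound_created sl).
(* Referencing a member of [C] is enough, as the certified pattern lies in the history of that
   member. *)
have done_ u y : u \in C -> u \in refs y ->
    exists2 Q, certificate_pattern v Q & {subset Q <= history y}.
  move=> /ceC[_ [_ [Q [ceQ sQ _]]]] uy; exists Q => // z /sQ zu.
  by apply: (mem_history uy); rewrite inE zu orbT.
move eq_n: (round x) => n; elim: n x eq_n => // n IHn x rx le_x xD hx.
have sub_refs y : y \in refs x -> y \in dag l' /\ holds_history l' y.
  move=> /mem_history hy; split=> [|z zy]; apply: hx; apply: hy; rewrite inE ?eqxx //.
  by rewrite zy orbT.
have /orP[/andP[qx /allP rrx]|/hasP[V VF /andP[/eqP rV /perm_mem eqr]]] :
    valid_vertex l' x by apply: (sound_valid sl'); rewrite ?rx.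
  have rn y : y \in refs x -> round y = n by move/rrx/eqP; rewrite rx => -[].
  have [eq_n | lt_n] : n = (round v).+2 \/ (round v).+2 < n by lia.
    rewrite eq_n in rn.
    have [u uC ux] := common_vertex sl sl' qC qx sC (fun y yx => (sub_refs y yx).1) rC rn.
    exact: done_ uC ux.
  have [y yx] := quorum_inhabited qx; have [yD hy] := sub_refs y yx.
  have [||Q ceQ sQ] := IHn y _ _ yD hy; first exact: rn.
    by lia.
  exists Q => // z /sQ zy; apply: (mem_history yx); rewrite inE zy orbT //.
have [_ [w OV]] := chain_mem (sound_chain sl') VF.
have := noF V VF.
(* [C] is a quorum of round [round v + 2]: if [V] has round [round v + 1], it would be a quorum
   right after an output; a fallback of higher round is excluded by [noF]. *)
have [eq_V | [eq_V _ | ? ?]] : fb_round V = (round v).+2 \/ fb_round V = (round v).+1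
    \/ (round v).+2 < fb_round V by lia.
- move=> _; rewrite -eq_V in rC.
  have [u uC uV] := quorum_meets_output facts OV qC crC rC.
  by apply: done_ uC _; rewrite eqr.
- rewrite -eq_V in rC; by case: (no_quorum_after_output facts OV qC crC rC).
- by lia.
Qed.

(** A node that has not acted on the fallback of round [r] is at round [r + 1] at most and holds no
    quorum of round [r + 1]. Both direct rules need such a quorum, and the indirect ones need a
    current round above [r + 2]. *)
Lemma fallback_decided l l' r v d : sound l -> sound l' ->
  fb_leader_at c l r = Some v -> marked c l' r d -> d = ToCommit v.
Proof.
move=> sl sl' fbv mk.
case fbv': (fb_leader_at c l' r) => [u|].
  rewrite (fb_leader_at_agree sl sl' fbv fbv').
  by case: mk fbv' => {r d fbv} [r w -> [->]|r d ->|r r' a w ->|r r' a ->].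
have [V [VF rV _]] := fb_leader_at_Some fbv.
have VN : V \notin fallbacks l' by apply: (@fb_leader_at_None l'); rewrite rV.
have [_ [w OV]] := chain_mem (sound_chain sl) VF.
have le_c := current_behind sl' (sound_chain sl) VF VN.
have no_quorum Q : quorum Q -> {subset Q <= dag l'} ->
    ~ (forall x, x \in Q -> round x = r.+1).
  move=> qQ sQ; rewrite -rV.
  exact: (no_quorum_after_output facts OV qQ (sub_created sQ (sound_created sl'))).
case: mk fbv' rV no_quorum => {r d fbv} [r u ->|r d fbN [{}u C lu qC sC ceC|sk]|
    r r' a u _ _ lt_r' _ _ _ _ _ _|r r' a _ _ lt_r' _ _ _ _ _] // _.
- move=> rV no_quorum; have [x xC] := quorum_inhabited qC.
  have [_ [_ [Q [ceQ _ sQ]]]] := ceC x xC.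
  have rQ := round_certificate_pattern ceQ.
  rewrite (round_leader_vertex sl' lu) in rQ.
  by case/andP: ceQ => qQ _; case: (no_quorum Q qQ sQ).
(* The direct skip rule ranges over all conceivable leader vertices; a dummy one suffices to extract
   a skip pattern. *)
- move=> rV no_quorum; have [|Q skQ sQ] := sk (Vertex r (leader c r) [::] [::]).
    by rewrite leader_vertex_default //= !eqxx.
  have rQ := round_skip_pattern skQ.
  by case/andP: skQ => qQ _; case: (no_quorum Q qQ sQ).
- by move=> rV _; lia.
- by move=> rV _; lia.
Qed.

(** * Agreement of the marks put on a round *)

Lemma commit_certified l r v : fb_leader_at c l r = None -> marked c l r (ToCommit v) ->
  exists2 Q, certificate_pattern v Q & {subset Q <= dag l}.
Proof.
move=> fbN mk; move eq_d: (ToCommit v) mk => d mk.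
case: mk fbN eq_d => {r d} [r u ->|r d _|r r' a u _ _ _ _ _ _ _ _ ceu _ [->]|//] //.
  case=> // u C _ qC _ ceC _ [->]; have [x xC] := quorum_inhabited qC.
  by have [_ [_ [Q [ceQ _ sQ]]]] := ceC x xC; exists Q.
by have [_ [Q [ceQ _ sQ]]] := ceu; exists Q.
Qed.

Lemma transfer_certificate l l' a v : holds_history l' a -> certificate l a v ->
  certificate l' a v.
Proof.
by move=> ha [lt_a [Q [ceQ sQ _]]]; split=> //; exists Q; split=> // x /sQ /ha.
Qed.

(** The common premises of the two indirect rules, [a] being the anchor on which the decision about
    [r] is based. *)
Definition anchored l r r' a :=
  [/\ r.+2 < r' <= current l, forall q, r.+2 < q < r' -> marked c l q (ToSkip f Tx),
      marked c l r' (ToCommit a), a \in dag l & holds_history l a].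

Lemma direct_commit_anchored l l' r v r' a : sound l -> sound l' ->
  fb_leader_at c l r = None -> fb_leader_at c l' r = None ->
  direct c l r (ToCommit v) -> anchored l' r r' a ->
  leader_vertex c l' r v /\ certificate l' a v.
Proof.
move=> sl sl' fbN fbN' dir; move eq_d: (ToCommit v) dir => d dir.
case: dir eq_d => // u C lu qC sC ceC [->] {d v} [/andP[lt_r' _] sk mk aD ha].
have ru := round_leader_vertex sl lu.
have ra := round_leader_vertex sl' (marked_leader_vertex mk).
split; first by move: lu; rewrite !leader_vertex_default.
have [|||Q ceQ sQ] := @certificate_in_history l l' u C r' a sl sl' qC sC _ _ _ aD ha.
- by move=> x xC; have [-> ce] := ceC x xC; rewrite ru.
(* The rounds strictly between [r + 2] and [r'] are marked to-skip, whereas the round of a fallback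
   can only be marked to-commit. *)
- move=> V VF; rewrite ru; apply/negP=> /sk skV.
  case fbV: (fb_leader_at c l' (fb_round V)) => [x|].
    by have := fallback_decided sl' sl' fbV skV.
  by have := fb_leader_at_None fbV; rewrite VF.
- by rewrite ru ra; lia.
by split; [rewrite ru ra; lia | exists Q; split=> // x /sQ /ha].
Qed.

Definition verdict l r a (d : decision f Tx) : Prop :=
  if d is ToCommit v then leader_vertex c l r v /\ certificate l a v
  else ~ (exists2 v, leader_vertex c l r v & certificate l a v).

Lemma marked_anchored l r d : fb_leader_at c l r = None -> marked c l r d ->
  direct c l r d \/ exists r' a, anchored l r r' a /\ verdict l r a d.
Proof.
move=> fbN mk; case: mk fbN => {r d} [r v ->|r d _ dir|
  r r' a v _ _ lt sk mk aD ha lv ce|r r' a _ _ lt sk mk aD ha Nce] // _; first by left.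
- by right; exists r', a.
- by right; exists r', a.
Qed.

Lemma commits_agree l l' r v v' : sound l -> sound l' ->
  fb_leader_at c l r = None -> fb_leader_at c l' r = None ->
  marked c l r (ToCommit v) -> marked c l' r (ToCommit v') -> v = v'.
Proof.
move=> sl sl' fbN fbN' mk mk'.
have [Q ceQ sQ] := commit_certified fbN mk.
have [Q' ceQ' sQ'] := commit_certified fbN' mk'.
by apply: certified_leader_uniq sl sl' fbN fbN' _ _ ceQ sQ ceQ' sQ'; apply: marked_leader_vertex.
Qed.

Lemma direct_skip_not_commit l l' r v : sound l -> sound l' ->
  fb_leader_at c l r = None -> fb_leader_at c l' r = None ->
  direct c l r (ToSkip f Tx) -> ~ marked c l' r (ToCommit v).
Proof.
move=> sl sl' fbN fbN' dir mk'; have lv := marked_leader_vertex mk'.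
have [Q' ceQ' sQ'] := commit_certified fbN' mk'.
move eq_d: (ToSkip f Tx) dir => d dir; case: dir eq_d => // sk _.
have [|Q skQ sQ] := sk v; first by move: lv; rewrite !leader_vertex_default.
exact: skipped_not_certified sl sl' skQ sQ ceQ' sQ'.
Qed.

(** A direct skip clashes with the certificate pattern behind the commit; an indirect one has an
    anchor, whose history contains such a pattern. *)
Lemma direct_commit_not_skip l l' r v : sound l -> sound l' ->
  fb_leader_at c l r = None -> fb_leader_at c l' r = None ->
  direct c l r (ToCommit v) -> ~ marked c l' r (ToSkip f Tx).
Proof.
move=> sl sl' fbN fbN' dir mk'.
have [dir'|[r' [a [anc []]]]] := marked_anchored fbN' mk'.
  exact: direct_skip_not_commit sl' sl fbN' fbN dir' (marked_direct fbN dir).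
by have [lv ce] := direct_commit_anchored sl sl' fbN fbN' dir anc; exists v.
Qed.

(** Both nodes hold the whole history of the anchor [a], so they see the same certificate patterns
    in it. *)
Lemma verdict_agree l l' r a d d' : sound l -> sound l' ->
  fb_leader_at c l r = None -> fb_leader_at c l' r = None ->
  holds_history l a -> holds_history l' a ->
  marked c l r d -> marked c l' r d' -> verdict l r a d -> verdict l' r a d' -> d = d'.
Proof.
move=> sl sl' fbN fbN' ha ha' mk mk'.
have lvE v : leader_vertex c l r v = leader_vertex c l' r v by rewrite !leader_vertex_default.
case: d d' mk mk' => [v|] [v'|] //= mk mk'.
- by move=> _ _; rewrite (commits_agree sl sl' fbN fbN' mk mk').
- by move=> [lv ce] []; exists v; [rewrite -lvE | apply: transfer_certificate ce].
- by move=> + [lv ce]; case; exists v'; [rewrite lvE | apply: transfer_certificate ce].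
Qed.

(** The hypotheses on marks have the form of the induction hypotheses of [marked_agree]: if one of
    [r'] and [r2] were smaller, that round would be marked to-commit by one node and to-skip by the
    other. *)
Lemma anchor_agree l' r r' a r2 b :
  r.+2 < r' ->
  (forall q, r.+2 < q < r' -> forall d, marked c l' q d -> ToSkip f Tx = d) ->
  (forall d, marked c l' r' d -> ToCommit a = d) ->
  anchored l' r r2 b -> a = b.
Proof.
move=> lt_r' skip_q commit_r' [/andP[lt_r2 _] sk2 mk2 _ _].
have [lt|lt|eq_r] := ltngtP r' r2.
- by have := commit_r' _ (sk2 r' _); rewrite lt_r' lt => /(_ isT).
- by have := skip_q r2 _ _ mk2; rewrite lt_r2 lt => /(_ isT).
- by rewrite eq_r in commit_r'; have [] := commit_r' _ mk2.
Qed.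

(** The induction is on the derivation of the first mark, whose indirect rules rest only on rounds
    above [r]; the second mark is merely analysed by cases. Equal anchors then give equal
    verdicts. *)
Lemma marked_agree l l' r d d' : sound l -> sound l' ->
  marked c l r d -> marked c l' r d' -> d = d'.
Proof.
move=> sl sl' mk; elim: mk d' => {r d} [r v fbv|r d fbN dir|
    r r' a v fbN Ndir lt_r' sk IHsk mk IHmk aD ha lv ceav|
    r r' a fbN Ndir lt_r' sk IHsk mk IHmk aD ha Nce] d' mk'.
- by rewrite (fallback_decided sl sl' fbv mk').
- have {}mk := marked_direct fbN dir.
  (* A fallback that only [l'] has acted on decides the round for both nodes. *)
  case fbN': (fb_leader_at c l' r) => [u|].
    by rewrite (fallback_decided sl' sl fbN' mk) (fallback_decided sl' sl' fbN' mk').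
  case: d d' dir mk mk' => [v|] [v'|] // dir mk mk'.
  + by rewrite (commits_agree sl sl' fbN fbN' mk mk').
  + by case: (direct_commit_not_skip sl sl' fbN fbN' dir mk').
  + by case: (direct_skip_not_commit sl sl' fbN fbN' dir mk').
- have {}mk := marked_indirect_commit fbN Ndir lt_r' sk mk aD ha lv ceav.
  case fbN': (fb_leader_at c l' r) => [u|].
    by rewrite (fallback_decided sl' sl fbN' mk) (fallback_decided sl' sl' fbN' mk').
  case/andP: lt_r' => lt_r' _.
  have [dir'|[r2 [b [anc' vd']]]] := marked_anchored fbN' mk'.
    case: d' dir' mk' => [v'|] dir' mk'; first by rewrite (commits_agree sl sl' fbN fbN' mk mk').
    by case: (direct_skip_not_commit sl' sl fbN' fbN dir' mk).
  have eq_ab := anchor_agree lt_r' IHsk IHmk anc'; case: anc' => _ _ _ _; rewrite -eq_ab => ha'.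
  by rewrite -eq_ab in vd'; apply: verdict_agree sl sl' fbN fbN' ha ha' mk mk' _ vd'.
- have {}mk := marked_indirect_skip fbN Ndir lt_r' sk mk aD ha Nce.
  case fbN': (fb_leader_at c l' r) => [u|].
    by rewrite (fallback_decided sl' sl fbN' mk) (fallback_decided sl' sl' fbN' mk').
  case/andP: lt_r' => lt_r' _.
  have [dir'|[r2 [b [anc' vd']]]] := marked_anchored fbN' mk'.
    case: d' dir' mk' => [v'|] dir' mk' //.
    by case: (direct_commit_not_skip sl' sl fbN' fbN dir' mk).
  have eq_ab := anchor_agree lt_r' IHsk IHmk anc'; case: anc' => _ _ _ _; rewrite -eq_ab => ha'.
  by rewrite -eq_ab in vd'; apply: verdict_agree sl sl' fbN fbN' ha ha' mk mk' _ vd'.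
Qed.

(** * Folding the marks into an order *)

Definition order_step (o : seq (vertex f Tx)) (d : decision f Tx) :=
  if d is ToCommit v then o ++ linearize c v o else o.

Definition settled r d := exists2 l, sound l & marked c l r d.

(** Round [0] is never decided, so entry [r] of [ds] is the decision on round [r.+1]. *)
Definition ordering l := exists ds,
  [/\ size ds = committed l, ordered l = foldl order_step [::] ds &
      forall r, r < size ds -> settled r.+1 (nth (ToSkip f Tx) ds r)].

Lemma settled_agree r d d' : settled r d -> settled r d' -> d = d'.
Proof. by case=> l sl mk [l' sl' mk']; apply: marked_agree sl sl' mk mk'. Qed.

Lemma sound_final l k o t : sound l -> sound (set_final k o t l).
Proof. by case: l => m w cu v d F b a p q s P y k0 o0 t0 [? ? ? ?]; split. Qed.

Lemma finalize_final t l l' : finalize_next c t l l' -> exists k o t', l' = set_final k o t' l.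
Proof. by case=> [v|] *; do 3 eexists. Qed.

Lemma ordering_finalize t l l' : sound l -> finalize_next c t l l' -> ordering l -> ordering l'.
Proof.
move=> sl fin [ds [szds eqo setds]].
suff [d sd [eqk eqor]] : exists2 d, settled (committed l).+1 d &
    committed l' = (committed l).+1 /\ ordered l' = order_step (ordered l) d.
  exists (rcons ds d); rewrite eqk eqor size_rcons szds foldl_rcons -eqo; split=> // r.
  rewrite ltnS leq_eqVlt nth_rcons szds => /predU1P[->|lt_r]; first by rewrite ltnn eqxx.
  by rewrite lt_r; apply: setds; rewrite szds.
case: fin => [v _ mk _ _|_ mk]; [exists (ToCommit v) | exists (ToSkip f Tx)]; try by exists l.
- by case: l {sl mk szds eqo}.
- by case: l {sl mk szds eqo}.
Qed.

(** Deciding touches only the bookkeeping of commits, which lets the other invariants ignore it. *)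
Lemma try_decide_final t l l' : try_decide c t l l' -> exists k o t', l' = set_final k o t' l.
Proof.
case=> + _; elim=> {l l'} [l l'|l|l l1 l2 _ [k [o [t' ->]]] _ [k' [o' [t1 ->]]]].
- exact: finalize_final.
- by exists (committed l), (ordered l), (last_commit l); case: l.
- by exists k', o', t1; case: l.
Qed.

Lemma ordering_try_decide t l l' : sound l -> try_decide c t l l' -> ordering l -> ordering l'.
Proof.
move=> sl [+ _] => steps.
suff: sound l' /\ (ordering l -> ordering l') by case.
elim: steps sl => {l l'} [l l' fin sl|//|l l1 l2 _ IH1 _ IH2 /IH1[/IH2[sl2 o2] o1]].
- split; last exact: ordering_finalize fin.
  by have [k [o [t' ->]]] := finalize_final fin; apply: sound_final.
- by split=> // /o1/o2.
Qed.

Lemma foldl_order_prefix o ds : prefix o (foldl order_step o ds).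
Proof.
elim: ds o => [|d ds IH] o /=; first exact: prefix_refl.
apply: prefix_trans (IH _); case: d => [v|] /=; last exact: prefix_refl.
exact: prefix_prefix.
Qed.

(** Settled decisions are unique, so the shorter list of decisions is an initial part of the longer
    one, and folding only appends. *)
Lemma ordering_prefix l l' : ordering l -> ordering l' -> committed l <= committed l' ->
  prefix (ordered l) (ordered l').
Proof.
move=> [ds [<- -> setds]] [ds' [<- -> setds']] le_s.
suff -> : ds = take (size ds) ds'.
  by rewrite -{2}(cat_take_drop (size ds) ds') foldl_cat foldl_order_prefix.
apply: (@eq_from_nth _ (ToSkip f Tx)) => [|r lt_r]; first by rewrite size_takel.
rewrite nth_take //; apply: settled_agree (setds _ lt_r) (setds' _ _).
exact: leq_trans lt_r le_s.
Qed.

End Agreement.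

(** * The inductive invariant of a correct node *)

Section Invariant.
Variables (f : nat) (Tx : eqType) (c : config f Tx) (byz : {set node f}).
Variable (O : nat -> acs_set f Tx -> Prop).
Implicit Types (N : seq (node f * msg f Tx)) (i j : node f) (l : lstate f Tx).
Implicit Types (x y : vertex f Tx) (sb : post f Tx) (V : acs_set f Tx).

(** The sender has to be the creator: a copy relayed by somebody else does not count. *)
Definition created N x := (creator x, MVertex x) \in N.

(** The last clause of [inv_proposal] freezes a node between its proposal and its action on the
    output; this is what keeps [inv_gap] true when vertices are created. *)
Record node_inv N i l : Prop := {
  inv_sound : sound byz (created N) O l;
  inv_current : current l = round (last_vertex l);
  inv_last : creator (last_vertex l) = i /\ created N (last_vertex l);
  inv_round : forall x, creator x = i -> created N x -> round x <= current l;
  inv_uniq : forall x y, creator x = i -> creator y = i -> created N x -> created N y ->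
    round x = round y -> x = y;
  inv_view : view l < current l;
  inv_proposal : forall w sb, proposal l w = Some sb ->
    [/\ w <= view l, creator (post_vertex sb) = i, created N (post_vertex sb),
        w < round (post_vertex sb) &
        w = view l -> lmode l = FP /\ post_vertex sb = last_vertex l];
  inv_output : forall w sb, proposal l w = Some sb -> w < view l ->
    exists2 V, output l w = Some V & fb_round V <= view l;
  (* What a node has created by its proposal in view w is not above the proposal;
     what it creates later is above the output of w. *)
  inv_gap : forall w sb x, proposal l w = Some sb -> creator x = i -> created N x ->
    round x <= round (post_vertex sb) \/
    exists2 V, output l w = Some V & (fb_round V).+2 <= round x;
  inv_buffer : forall x, MVertex x \in buffer l -> creator x \notin byz -> created N x
}.

Definition net_inv N := forall s x, (s, MVertex x) \in N -> creator x \notin byz -> created N x.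

Lemma valid_vertex_mono l l' x : {subset fallbacks l <= fallbacks l'} ->
  valid_vertex l x -> valid_vertex l' x.
Proof.
move=> sF /orP[reg|/hasP[V /sF VF hV]]; first by rewrite /valid_vertex reg.
by apply/orP; right; apply/hasP; exists V.
Qed.

(** Meant for the steps in which the node neither creates a vertex nor proposes. *)
Lemma node_inv_frame N N' i l l' : node_inv N i l -> {subset N <= N'} ->
  (forall x, creator x = i -> created N' x -> created N x) ->
  current l' = current l -> last_vertex l' = last_vertex l -> view l' = view l ->
  fallbacks l' = fallbacks l -> proposal l' = proposal l ->
  (lmode l = FP -> lmode l' = FP) ->
  (forall w V, output l w = Some V -> output l' w = Some V) ->
  {subset dag l <= dag l'} ->
  (forall x, x \in dag l' -> x \in dag l \/
     valid_vertex l x /\ (creator x \notin byz -> created N' x)) ->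
  (forall x, MVertex x \in buffer l' -> MVertex x \in buffer l \/
     (creator x \notin byz -> created N' x)) ->
  node_inv N' i l'.
Proof.
move=> [[crD vaD ch qu] cur [cl crl] rnd un vw pr ou ga bu] sN newN ecur elast eview efb epr
  emode eout sD newD newB.
have sC x : created N x -> created N' x by apply: sN.
have eva x : valid_vertex l' x = valid_vertex l x by rewrite /valid_vertex efb.
split; rewrite ?ecur ?elast ?eview ?epr //.
- split; rewrite ?eview ?efb ?ecur //.
  + by move=> x /newD[xD r0 xN|[_ crx] _ //]; apply: sC; apply: crD.
  + by move=> x /newD[xD r0|[vx _ _]]; rewrite eva //; apply: vaD.
  + by move=> r /qu[Q [qQ sQ rQ]]; exists Q; split=> // x /sQ; apply: sD.
- by split=> //; apply: sC.
- by move=> x cx crx; apply: rnd => //; apply: newN.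
- by move=> x y cx cy crx cry; apply: un => //; apply: newN.
- by move=> w sb /pr[? ? cr ? mo]; split=> // [|/mo[/emode]]; first exact: sC.
- by move=> w sb psb /(ou _ _ psb)[V oV leV]; exists V => //; apply: eout.
- move=> w sb x psb cx crx;
  case: (ga w sb x psb cx (newN x cx crx)) => [|[V oV leV]]; first by left.
  by right; exists V => //; apply: eout.
- by move=> x /newB[xB xN|//]; apply: sC; apply: bu.
Qed.

Lemma node_inv_silent N N' i l l' : node_inv N i l -> {subset N <= N'} ->
  (forall x, creator x = i -> created N' x -> created N x) ->
  current l' = current l -> last_vertex l' = last_vertex l -> view l' = view l ->
  fallbacks l' = fallbacks l -> proposal l' = proposal l ->
  (lmode l = FP -> lmode l' = FP) ->
  (forall w V, output l w = Some V -> output l' w = Some V) ->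
  dag l' = dag l -> {subset buffer l' <= buffer l} -> node_inv N' i l'.
Proof.
move=> inv sN newN ecur elast eview efb epr emode eout edag sB.
by apply: node_inv_frame inv sN newN ecur elast eview efb epr emode eout _ _ _;
  rewrite ?edag // => x; [left | move/sB; left].
Qed.

Lemma created_cons N i x y : created ((i, MVertex x) :: N) y -> y = x \/ created N y.
Proof. by rewrite /created inE => /orP[/eqP[_ ->]|]; [left | right]. Qed.

Lemma inv_room N i l w sb : node_inv N i l -> proposal l w = Some sb ->
  lmode l = OP -> w < view l.
Proof.
move=> inv psb op; have [le_w _ _ _ mo] := inv_proposal inv psb.
by rewrite ltn_neqAle le_w andbT; apply/eqP=> /mo[]; rewrite op.
Qed.

Lemma node_inv_enter N i l l' Q x : node_inv N i l -> lmode l = OP ->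
  quorum Q -> {subset Q <= dag l} -> all (fun u => round u == current l) Q ->
  round x = (current l).+1 -> creator x = i -> regular_refs x ->
  current l' = round x -> last_vertex l' = x -> view l' = view l ->
  fallbacks l' = fallbacks l -> proposal l' = proposal l -> output l' = output l ->
  dag l' = x :: dag l -> buffer l' = buffer l ->
  node_inv ((i, MVertex x) :: N) i l'.
Proof.
move=> inv op qQ sQ /allP rQ rx cx reg ecur elast eview efb epr eout edag ebuf.
have room w sb (psb : proposal l w = Some sb) := inv_room inv psb op.
case: inv => [[crD vaD ch qu] cur [cl crl] rnd un vw pr ou ga bu].
have sC y : created N y -> created ((i, MVertex x) :: N) y.
  by rewrite /created inE orbC => ->.
have crx : created ((i, MVertex x) :: N) x by rewrite /created cx mem_head.
split; rewrite ?ecur ?elast ?eview ?epr ?eout //.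
- split; rewrite ?eview ?efb ?ecur ?edag //.
  + by move=> y; rewrite inE => /predU1P[-> //|yD r0 yN]; apply: sC; apply: crD.
  + move=> y; rewrite inE => /predU1P[-> _|yD r0]; first by rewrite /valid_vertex reg.
    by apply: valid_vertex_mono (vaD _ yD r0) => V; rewrite efb.
  + move=> r; rewrite rx ltnS (leq_eqVlt r) => /andP[lt_r /orP[/eqP ->|le_r]].
      (* The round being left joins the range of [sound_quorum], with [Q] as its quorum. *)
      exists Q; split=> // [y /sQ yD|y /rQ/eqP //]; by rewrite inE yD orbT.
    have [|Q' [qQ' sQ' rQ']] := qu r; first by rewrite lt_r.
    by exists Q'; split=> // y /sQ' yD; rewrite inE yD orbT.
- by move=> y cy /created_cons[->//|cry]; rewrite rx; apply: leqW; apply: rnd.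
- move=> y z cy cz /created_cons[->|cry] /created_cons[->|crz] //; last exact: un.
    by have := rnd _ cz crz; rewrite rx; lia.
  by have := rnd _ cy cry; rewrite rx; lia.
- by rewrite rx; apply: leqW.
- move=> w sb psb; have [? ? cr ? mo] := pr w sb psb; split=> //; first exact: sC.
  by move=> eqw; have := room _ _ psb; rewrite eqw ltnn.
- move=> w sb y psb cy /created_cons[->|]; last exact: ga psb cy.
  (* In mode OP all proposals belong to past views, so [fb_round V <= view l < current l], and the
     new round [current l + 1] is beyond the gap. *)
  by right; have [V oV leV] := ou _ _ psb (room _ _ psb); exists V; rewrite // rx; lia.
- by move=> y; rewrite ebuf => /bu + yN => /(_ yN)/sC.
Qed.

(** The bound on [current l] makes [fb_round V + 2] a fresh round for the node, so the jump cannot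
    produce a second vertex in a round. *)
Lemma node_inv_return N i l l' V x : node_inv N i l ->
  output l (view l) = Some V -> O (view l) V ->
  view l < fb_round V -> current l <= (fb_round V).+1 ->
  round x = (fb_round V).+2 -> creator x = i -> refs x = fb_refs V ->
  current l' = round x -> last_vertex l' = x -> view l' = fb_round V ->
  fallbacks l' = V :: fallbacks l -> proposal l' = proposal l -> output l' = output l ->
  dag l' = x :: dag l -> buffer l' = buffer l ->
  node_inv ((i, MVertex x) :: N) i l'.
Proof.
move=> [[crD vaD ch qu] cur [cl crl] rnd un vw pr ou ga bu] oV OV lt_vw le_cur rx cx refx
  ecur elast eview efb epr eout edag ebuf.
have sC y : created N y -> created ((i, MVertex x) :: N) y.
  by rewrite /created inE orbC => ->.
have crx : created ((i, MVertex x) :: N) x by rewrite /created cx mem_head.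
have out_below w sb : proposal l w = Some sb ->
    exists2 V', output l w = Some V' & fb_round V' <= fb_round V.
  move=> psb; have [le_w _ _ _ _] := pr _ _ psb.
  move: le_w; rewrite leq_eqVlt => /predU1P[->|/(ou _ _ psb)[V' oV' leV']]; first by exists V.
  by exists V' => //; apply: leq_trans leV' (ltnW lt_vw).
split; rewrite ?ecur ?elast ?eview ?epr ?eout //.
- split; rewrite ?eview ?efb ?ecur ?edag //.
  + by move=> y; rewrite inE => /predU1P[-> //|yD r0 yN]; apply: sC; apply: crD.
  + move=> y; rewrite inE => /predU1P[-> _|yD r0].
      by apply/orP; right; rewrite efb /= rx refx eqxx perm_refl.
    by apply: valid_vertex_mono (vaD _ yD r0) => V'; rewrite efb inE orbC => ->.
  + exact: chain_cons ch OV.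
  (* No round lies strictly between [fb_round V + 1] and [fb_round V + 2]. *)
  + by move=> r; rewrite rx; lia.
- by move=> y cy /created_cons[->//|cry]; have := rnd _ cy cry; rewrite rx; lia.
- move=> y z cy cz /created_cons[->|cry] /created_cons[->|crz] //; last exact: un.
    by have := rnd _ cz crz; rewrite rx; lia.
  by have := rnd _ cy cry; rewrite rx; lia.
- by rewrite rx; lia.
- move=> w sb psb; have [? ? cr ? mo] := pr w sb psb; split=> //; try exact: sC; lia.
- by move=> w sb psb _; apply: out_below psb.
- move=> w sb y psb cy /created_cons[->|]; last exact: ga psb cy.
  by right; have [V' oV' leV'] := out_below _ _ psb; exists V'; rewrite // rx; lia.
- by move=> y; rewrite ebuf => /bu + yN => /(_ yN)/sC.
Qed.

Lemma node_inv_propose N i l : node_inv N i l -> lmode l = FP -> proposal l (view l) = None ->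
  node_inv N i (set_proposal (fset_at (proposal l) (view l) (own_post i l)) l).
Proof.
case: l => m vw cu lv d F b a p q s P y k o t
  [[/= crD vaD ch qu] /= cur [cl crl] rnd un lt_vw pr ou ga bu] fp _.
split=> //=.
- move=> w sb; rewrite /fset_at; case: eqP => [-> [<-]|_ /pr//] /=.
  by rewrite -cur.
- by move=> w sb; rewrite /fset_at; case: eqP => [-> _|_ /ou//]; rewrite ltnn.
- move=> w sb x; rewrite /fset_at; case: eqP => [-> [<-] cx crx|_ psb]; last exact: ga psb.
  by left; rewrite /= -cur rnd.
Qed.

Lemma output_decide l w V w' V' : output l w = None -> output l w' = Some V' ->
  output (set_output (fset_at (output l) w V) l) w' = Some V'.
Proof.
move=> oN oV'; have -> : output (set_output (fset_at (output l) w V) l) = fset_at (output l) w V.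
  by case: (l).
by rewrite /fset_at; case: eqP => // eqw; rewrite eqw oN in oV'.
Qed.

(** What a local step must know about the ACS; proving it involves the proposals of other nodes,
    hence the global invariant. *)
Definition output_ok l := forall V, output l (view l) = Some V ->
  [/\ O (view l) V, view l < fb_round V & current l <= (fb_round V).+1].

Lemma lstep_inv N i t l l' out : net_inv N -> i \notin byz -> node_inv N i l -> output_ok l ->
  lstep c i t l l' out -> node_inv ([seq (i, m) | m <- out] ++ N) i l'.
Proof.
move=> netN iN inv ok st.
have sub_cat out' : {subset N <= [seq (i, m) | m <- out'] ++ N}.
  by move=> z zN; rewrite mem_cat zN orbT.
have inB := inv_buffer inv.
case: st => {l' out}.
- move=> x Q l' op _ qQ sQ rQ rx cx reg _ _ /try_decide_final[k [o [t' ->]]].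
  by apply: (node_inv_enter inv op qQ sQ rQ rx cx reg); case: (l).
- move=> x l' xB xN vx /try_decide_final[k [o [t' ->]]].
  apply: (node_inv_frame inv) => //; try by case: (l).
  + by case: (l) => * ?; rewrite /= inE orbC => ->.
  + set l1 := set_final _ _ _ _; have -> : dag l1 = x :: dag l by rewrite /l1; case: (l).
    by move=> y; rewrite inE => /predU1P[->|]; [right; split=> // /(inB _ xB) | left].
  + set l1 := set_final _ _ _ _.
    have -> : buffer l1 = rem (MVertex x) (buffer l) by rewrite /l1; case: (l).
    by move=> y /mem_rem; left.
- move=> x xB _; apply: (node_inv_silent inv) => //; try by case: (l).
  by case: (l) => * ? /mem_rem.
- move=> op _; apply: (node_inv_silent inv) => //; try by case: (l).
    by move=> x _; rewrite /created inE => /predU1P[[]|].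
  by case: (l) => * ?.
- move=> sb sbB l1 _ _; apply: (node_inv_silent inv) => //; rewrite ?/l1; try by case: (l).
    by move=> x _; rewrite /created inE => /predU1P[[]|].
  by case: (l) => * ? /mem_rem.
- move=> sb sbB l1 _ _ _; apply: (node_inv_silent inv) => //; rewrite ?/l1; try by case: (l).
  by case: (l) => * ? /mem_rem.
- move=> sb sbB l1 _; apply: (node_inv_silent inv) => //; rewrite ?/l1; try by case: (l).
  by case: (l) => * ? /mem_rem.
- move=> sb _ _; apply: (node_inv_silent inv) => //; try by case: (l).
    by move=> x _; rewrite /created inE => /predU1P[[]|].
  by case: (l) => * ?.
- move=> sb k sbB; apply: (node_inv_silent inv) => //; try by case: (l).
  by case: (l) => * ? /mem_rem.
- by move=> S fp psb _ _; apply: node_inv_propose.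
- move=> w V oV; apply: (node_inv_silent inv) => //; try by case: (l).
    by move=> w' V' oV'; apply: output_decide.
  by case: (l) => * ?.
- move=> V txs l1 l' oV _ /try_decide_final[k [o [t1 ->]]] x /try_decide_final[k' [o' [t2 ->]]].
  have [OV lt_vw le_cur] := ok _ oV.
  by apply: (node_inv_return inv oV OV lt_vw le_cur); case: (l).
Qed.

Lemma lstep_creator i t l l' out x : lstep c i t l l' out -> MVertex x \in out -> creator x = i.
Proof.
case=> {l' out} //.
- by move=> y Q l' _ _ _ _ _ _ <- _ _ _ _; rewrite inE => /eqP[->].
- by move=> V txs l1 l' _ _ _ y _; rewrite inE => /eqP[->].
Qed.

Lemma lstep_output i t l l' out w V : lstep c i t l l' out ->
  output l w = Some V -> output l' w = Some V.
Proof.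
case=> {l' out} //; try by case: (l).
- by move=> x Q l' _ _ _ _ _ _ _ _ _ _ /try_decide_final[k [o [t' ->]]]; case: (l).
- by move=> x l' _ _ _ /try_decide_final[k [o [t' ->]]]; case: (l).
- by move=> w' V' ? ?; apply: output_decide.
- move=> V' txs l1 l' _ _ /try_decide_final[k [o [t1 ->]]] x /try_decide_final[k' [o' [t2 ->]]].
  by case: (l).
Qed.

(** * Preservation of the order by local steps *)

Section Ordering.
Variable (E : vertex f Tx -> Prop).

Lemma sound_mono (E' : vertex f Tx -> Prop) l : (forall x, E' x -> E x) ->
  sound byz E' O l -> sound byz E O l.
Proof. by move=> sE [crD ? ? ?]; split=> // x xD r0 xN; apply/sE/crD. Qed.

Lemma sound_before_try_decide t l l' : try_decide c t l l' ->
  sound byz E O l' -> sound byz E O l.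
Proof.
move=> /try_decide_final[k [o [t' ->]]].
by case: (l) => m w cu v d F b a p q s P y k0 o0 t0 [? ? ? ?]; split.
Qed.

(** In a return, the first [try_decide] starts from this intermediate state, whose soundness the
    invariant on states of the run does not give. *)
Lemma sound_fallback l V : sound byz E O l -> O (view l) V -> sound byz E O (set_fallback V l).
Proof.
case: l => m w cu v d F b a p q s P y k0 o0 t0 [/= crD vaD ch qu] OV; split=> //=.
- move=> x xD r0; apply: valid_vertex_mono (vaD x xD r0) => V' /=.
  by rewrite inE orbC => ->.
- exact: chain_cons OV.
- by move=> r; lia.
Qed.

Lemma ordering_same l l' : committed l' = committed l -> ordered l' = ordered l ->
  ordering c byz E O l -> ordering c byz E O l'.
Proof. by move=> ek eo [ds [? ? ?]]; exists ds; rewrite ek eo. Qed.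

Lemma lstep_ordering i t l l' out : output_ok l -> sound byz E O l -> sound byz E O l' ->
  lstep c i t l l' out -> ordering c byz E O l -> ordering c byz E O l'.
Proof.
move=> ok sl sl' st ol.
have decide l1 l2 : sound byz E O l2 -> try_decide c t l1 l2 ->
    ordering c byz E O l1 -> ordering c byz E O l2.
  move=> sl2 dec.
  exact: ordering_try_decide (sound_before_try_decide dec sl2) dec.
case: st sl' => {l' out}; cbv zeta; try by intros; apply: ordering_same ol; case: (l).
- move=> x Q l' _ _ _ _ _ _ _ _ _ _ dec sl'.
  by apply: decide _ _ sl' dec _; apply: ordering_same ol; case: (l).
- move=> x l' _ _ _ dec sl'.
  by apply: decide _ _ sl' dec _; apply: ordering_same ol; case: (l).
- move=> V txs l1 l' oV _ dec1 dec2 sl'.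
  have [OV _ _] := ok _ oV.
  apply: decide _ _ sl' dec2 _; apply: (@ordering_same l1); try by case: (l1).
  apply: (ordering_try_decide (sound_fallback sl OV) dec1).
  by apply: ordering_same ol; case: (l).
Qed.

End Ordering.

End Invariant.

(** * The invariant along a whole run *)

Section Run.
Variables (f : nat) (Tx : eqType) (c : config f Tx) (byz : {set node f}).
Variable (e : nat -> gstate f Tx).
Hypotheses (byz_le : #|byz| <= f) (exec : execution c byz e) (acs : acs_spec byz e).
Implicit Types (i j : node f) (l : lstate f Tx).
Implicit Types (x y : vertex f Tx) (sb : post f Tx) (V : acs_set f Tx) (Q : seq (vertex f Tx)).

Definition decided w V := exists k i, i \notin byz /\ output (loc (e k) i) w = Some V.
Definition ever_created x := exists k, created (net (e k)) x.

Lemma net_mono k k' : k <= k' -> {subset net (e k) <= net (e k')}.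
Proof.
move=> /subnK <-; elim: (k' - k) => // n IHn m /IHn {IHn}.
rewrite addSn; case: (execution_step exec (n + k)) => //= [i l' out _ _|b m' _ _] mN.
  by rewrite mem_cat mN orbT.
by rewrite inE mN orbT.
Qed.

Lemma output_mono k k' i w V : k <= k' -> i \notin byz ->
  output (loc (e k) i) w = Some V -> output (loc (e k') i) w = Some V.
Proof.
move=> /subnK <- iN; elim: (k' - k) => // n IHn /IHn {IHn}; rewrite addSn.
case: (execution_step exec (n + k)) => //= [j l' out _ st|j x l' _ _ _ _ dec|j s m _ _ _];
  rewrite /set_loc; case: eqP => // -> oV.
- exact: lstep_output st oV.
- by have [k0 [o [t ->]]] := try_decide_final dec; case: (loc _ j) oV.
- by case: ifP; case: (loc _ j) oV.
Qed.

(** Agreement brings the first output to the second node at some time, and a node never overwrites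
    an output. *)
Lemma decided_fun w V V' : decided w V -> decided w V' -> V = V'.
Proof.
move=> [k [i [iN oV]]] [k' [j [jN oV']]].
have [m oVj] := acs_agreement acs iN oV jN.
have := output_mono (leq_maxl m k') jN oVj.
by rewrite (output_mono (leq_maxr m k') jN oV') => -[].
Qed.

Lemma acs_quorum k i w V : i \notin byz -> output (loc (e k) i) w = Some V ->
  quorum_size f <= #|[set j | V j]|.
Proof.
move=> iN /(acs_validity acs iN)[le_V _ _].
by apply: leq_trans le_V; rewrite /quorum_size; lia.
Qed.

Definition invariant k := net_inv byz (net (e k)) /\
  forall i, i \notin byz -> node_inv byz decided (net (e k)) i (loc (e k) i).

Section Output.
Variables (k : nat) (i : node f) (w : nat) (V : acs_set f Tx).
Hypotheses (inv : invariant k) (iN : i \notin byz) (oV : output (loc (e k) i) w = Some V).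

Lemma acs_proposal j sb : j \notin byz -> V j = Some sb ->
  proposal (loc (e k) j) w = Some sb /\ round (post_vertex sb) <= fb_round V.
Proof.
move=> jN Vj; have [_ _ /(_ j sb jN Vj) psb] := acs_validity acs iN oV.
by split=> //; apply: round_le_fb_round (mem_posts_of Vj).
Qed.

(** [inv_gap] speaks of the output at [j] itself; agreement identifies it with [V]. *)
Lemma acs_gap j sb x : j \notin byz -> V j = Some sb -> creator x = j ->
  created (net (e k)) x ->
  round x <= round (post_vertex sb) \/ (fb_round V).+2 <= round x.
Proof.
move=> jN Vj cx crx; have [psb _] := acs_proposal jN Vj.
have [|[V' oV' le_x]] := inv_gap (inv.2 j jN) psb cx crx; [by left | right].
suff -> : V = V' by [].
by apply: (@decided_fun w); [exists k, i | exists k, j].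
Qed.

Lemma output_gt_view : w < fb_round V.
Proof.
have qV := acs_quorum iN oV.
(* Intersecting the set of proposers with itself yields a correct proposer. *)
have [j [+ _ jN]] := large_sets_meet byz_le qV qV.
rewrite inE; case eq_sb: (V j) => [sb|] // _.
have [psb] := acs_proposal jN eq_sb; apply: leq_trans.
by have [_ _ _ ] := inv_proposal (inv.2 j jN) psb.
Qed.

Lemma no_quorum_above_output Q : quorum Q -> correct_created byz (created (net (e k))) Q ->
  ~ (forall x, x \in Q -> round x = (fb_round V).+1).
Proof.
move=> qQ crQ rQ.
have [x [sb [xQ xN Vx]]] := quorum_meets_acs byz_le qQ (acs_quorum iN oV).
have rx := rQ x xQ; have [_ le_sb] := acs_proposal xN Vx.
have [] := acs_gap xN Vx (erefl _) (crQ x xQ _ xN); rewrite rx => //; lia.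
Qed.

(** A correct creator shared with [V] has its vertex of round [fb_round V] below the gap; the
    proposed vertex then has the same round, so it is the same vertex. *)
Lemma quorum_at_output Q : quorum Q -> correct_created byz (created (net (e k))) Q ->
  (forall x, x \in Q -> round x = fb_round V) -> exists2 x, x \in Q & x \in fb_refs V.
Proof.
move=> qQ crQ rQ.
have [x [sb [xQ xN Vx]]] := quorum_meets_acs byz_le qQ (acs_quorum iN oV).
have rx := rQ x xQ; have [psb le_sb] := acs_proposal xN Vx.
have crx : created (net (e k)) x.
  by apply: crQ => //; rewrite rx; apply: leq_ltn_trans output_gt_view.
have [|] := acs_gap xN Vx (erefl _) crx; rewrite rx => le_x; last lia.
have [_ csb crsb _ _] := inv_proposal (inv.2 _ xN) psb.
exists x => //; have -> : x = post_vertex sb.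
  by apply: (inv_uniq (inv.2 _ xN)) => //; rewrite rx; apply/eqP; rewrite eqn_leq le_x.
exact: map_f (mem_posts_of Vx).
Qed.

End Output.

(** The argument of [current_behind], carried out at a fixed time: [run_facts] is only obtained once
    the invariant holds throughout. *)
Lemma output_ok_invariant k i : invariant k -> i \notin byz -> output_ok decided (loc (e k) i).
Proof.
move=> inv iN V oV; have lt_vw := output_gt_view inv iN oV.
split=> //; first by exists k, i.
rewrite leqNgt; apply/negP=> lt_c; have sl := inv_sound (inv.2 i iN).
have [|Q [qQ sQ rQ]] := sound_quorum sl (r := (fb_round V).+1); first by rewrite ltnS lt_vw.
exact: (no_quorum_above_output inv iN oV qQ (sub_created sQ (sound_created sl))) rQ.
Qed.

Lemma invariant_init : invariant 0.
Proof.
have [v1 [init_v netE _]] := execution_init exec.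
have created_v x : created (net (e 0)) x -> x = v1 (creator x) /\ creator x \notin byz.
  rewrite /created netE => /mapP[j]; rewrite mem_enum inE => jN [cx eqx].
  by rewrite cx.
split=> [s x|i iN].
  rewrite netE => /mapP[j jN [_ eqx]] _.
  apply/mapP; exists j => //; move: jN; rewrite mem_enum inE => jN.
  by rewrite eqx; have [_ -> _ _ _] := init_v j jN.
have [rv cv reg sub ->] := init_v i iN.
have cr_v : created (net (e 0)) (v1 i).
  by rewrite /created netE; apply/mapP; exists i; rewrite ?cv // mem_enum inE.
have genesis0 x : x \in genesis_dag f Tx -> round x = 0 by case/mapP=> j _ ->.
split=> //=.
- split=> //=.
  + by move=> x; rewrite inE => /predU1P[->//|/genesis0 ->].
  + move=> x; rewrite inE => /predU1P[-> _|/genesis0 -> //].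
    by rewrite /valid_vertex reg.
  + exact: chain_nil.
  + by move=> r; lia.
- by move=> x cx /created_v[-> _]; rewrite cx rv.
- by move=> x y cx cy /created_v[-> _] /created_v[-> _]; rewrite cx cy.
Qed.

Lemma node_inv_other O N i j l out : node_inv byz O N j l -> j != i ->
  node_inv byz O ([seq (i, m) | m <- out] ++ N) j l.
Proof.
move=> inv neq; apply: (node_inv_silent inv) => // [z zN|x cx]; first by rewrite mem_cat zN orbT.
by rewrite /created mem_cat => /orP[/mapP[m _ [eqi _]]|//]; rewrite -eqi cx eqxx in neq.
Qed.

Lemma authentic_created g x : authentic byz g (MVertex x) -> creator x \notin byz ->
  created (net g) x.
Proof. by case=> // + /negP. Qed.

Lemma invariant_step k : invariant k -> invariant k.+1.
Proof.
rewrite /invariant => inv; have ok i := output_ok_invariant inv (i := i).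
move: inv ok; case: (execution_step exec k) => /=
    [i l' out iN st|i x l' iN _ auth vx dec|i s m iN mN _|b m bB auth|] [netI nodeI] ok.
- split=> [s x|j jN].
    rewrite mem_cat => /orP[/mapP[m mo [_ eqm]]|xN cN]; last first.
      by rewrite /created mem_cat [X in _ || X](netI _ _ xN cN) orbT.
    rewrite -eqm in mo; have cx := lstep_creator st mo; move=> _.
    by rewrite /created mem_cat cx map_f.
  rewrite /set_loc; case: eqP => [->|/eqP neq]; last exact: node_inv_other (nodeI j jN) neq.
  exact: lstep_inv netI iN (nodeI i iN) (ok i iN) st.
- split=> // j jN; rewrite /set_loc; case: eqP => [->|_]; last exact: nodeI.
  have [k0 [o [t ->]]] := try_decide_final dec.
  apply: (node_inv_frame (nodeI i iN)) => //; try by case: (loc _ i).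
  + by case: (loc _ i) => * ?; rewrite /= inE orbC => ->.
  + set l1 := set_final _ _ _ _.
    have -> : dag l1 = x :: dag (loc (e k) i) by rewrite /l1; case: (loc _ i).
    move=> y; rewrite inE => /predU1P[->|]; [right; split=> //| by left].
    exact: authentic_created.
  + set l1 := set_final _ _ _ _.
    have -> : buffer l1 = buffer (loc (e k) i) by rewrite /l1; case: (loc _ i).
    by left.
- split=> // j jN; rewrite /set_loc; case: eqP => [->|_]; last exact: nodeI.
  case: ifP => _; last first.
    apply: (node_inv_silent (nodeI i iN)) => //; try by case: (loc _ i).
    by case: (loc _ i) => * ?.
  set l1 := set_buffer _ _.
  apply: (node_inv_frame (nodeI i iN)) => //; rewrite ?/l1; try by case: (loc _ i).
  + by case: (loc _ i) => * ?.
  + rewrite -/l1; have -> : dag l1 = dag (loc (e k) i) by rewrite /l1; case: (loc _ i).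
    by left.
  + have -> : buffer (set_buffer (rcons (buffer (loc (e k) i)) m)
        (set_arrived (m :: arrived (loc (e k) i)) (loc (e k) i))) = rcons (buffer (loc (e k) i)) m.
      by case: (loc _ i).
    move=> x; rewrite mem_rcons inE => /predU1P[eqm|]; [right | by left].
    by rewrite -eqm in mN; apply: netI mN.
- split=> [s x|j jN].
    rewrite inE => /orP[/eqP[_ eqm]|xN] cN.
      by rewrite -eqm in auth; rewrite /created inE orbC [X in X || _](authentic_created auth cN).
    by rewrite /created inE orbC [X in X || _](netI _ _ xN cN).
  apply: (node_inv_other [:: m] (nodeI j jN)).
  by apply: contraNneq jN => ->.
- by [].
Qed.

Lemma invariant_all k : invariant k.
Proof. by elim: k => [|k]; [exact: invariant_init | exact: invariant_step]. Qed.

Lemma created_mono k k' x : k <= k' -> created (net (e k)) x -> created (net (e k')) x.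
Proof. by move/net_mono; apply. Qed.

(** [Q] is finite, so one late enough time serves all its vertices. *)
Lemma created_by Q : correct_created byz ever_created Q ->
  exists k, correct_created byz (created (net (e k))) Q.
Proof.
elim: Q => [|x Q IHQ] crQ; first by exists 0.
have [|k crk] := IHQ; first by move=> y yQ; apply: crQ; rewrite inE yQ orbT.
have [/andP[r0 xN]|Nx] := boolP ((0 < round x) && (creator x \notin byz)).
  have [k' crx] := crQ x (mem_head _ _) r0 xN.
  exists (maxn k k') => y; rewrite inE => /predU1P[->|yQ] ry yN.
    exact: created_mono (leq_maxr _ _) crx.
  exact: created_mono (leq_maxl _ _) (crk y yQ ry yN).
exists k => y; rewrite inE => /predU1P[->|yQ] ry yN; last exact: crk.
by rewrite ry yN in Nx.
Qed.

Lemma run_facts_execution : run_facts byz ever_created decided.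
Proof.
have at_time w V Q : decided w V -> correct_created byz ever_created Q ->
    exists k i, [/\ i \notin byz, output (loc (e k) i) w = Some V &
      correct_created byz (created (net (e k))) Q].
  move=> [k [i [iN oV]]] /created_by[k' crQ]; exists (maxn k k'), i; split=> //.
    exact: output_mono (leq_maxl _ _) iN oV.
  by move=> x xQ rx xN; apply: created_mono (leq_maxr _ _) (crQ x xQ rx xN).
split.
- move=> x y [k crx] [k' cry] eqc xN eqr.
  apply: (inv_uniq ((invariant_all (maxn k k')).2 _ xN)) => //.
    exact: created_mono (leq_maxl _ _) crx.
  exact: created_mono (leq_maxr _ _) cry.
- exact: decided_fun.
- by move=> w V [k [i [iN oV]]]; apply: output_gt_view (invariant_all k) iN oV.
- move=> w V Q /at_time atV qQ /atV[k [i [iN oV crQ]]].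
  exact (no_quorum_above_output (invariant_all k) iN oV qQ crQ).
- move=> w V Q /at_time atV qQ /atV[k [i [iN oV crQ]]].
  exact (quorum_at_output (invariant_all k) iN oV qQ crQ).
Qed.

Lemma sound_execution k i : i \notin byz -> sound byz ever_created decided (loc (e k) i).
Proof.
move=> iN; apply: sound_mono (inv_sound ((invariant_all k).2 i iN)) => x crx.
by exists k.
Qed.

Lemma ordering_execution k i : i \notin byz ->
  ordering c byz ever_created decided (loc (e k) i).
Proof.
move=> iN; elim: k => [|k IHk].
  have [v1 [init_v _ _]] := execution_init exec.
  by have [_ _ _ _ ->] := init_v i iN; exists [::].
have := sound_execution k iN; have := sound_execution k.+1 iN.
have := output_ok_invariant (invariant_all k) iN; move: IHk.
case: (execution_step exec k) => //=
    [j l' out _ st|j x l' _ _ _ _ dec|j s m _ _ _];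
  rewrite /set_loc; case: eqP => // -> ol ok sl' sl.
- exact: lstep_ordering ok sl sl' st ol.
- apply: (ordering_try_decide (sound_before_try_decide dec sl') dec).
  by apply: ordering_same ol; case: (loc _ j).
- by apply: ordering_same ol; case: ifP; case: (loc _ j).
Qed.

End Run.

(** * From orders of vertices to ledgers *)

Lemma delivers_before_prefix (Tx : eqType) (L L' : seq Tx) tx tx' :
  prefix L L' || prefix L' L -> delivers_before L tx tx' -> tx' \in L' ->
  delivers_before L' tx tx'.
Proof.
rewrite /delivers_before => /orP[]/prefixP[S ->].
  (* When [L'] extends [L], the index of [tx] is unchanged, and [tx'] is either in [L] or beyond its
     end. *)
  move=> lt _; have txL : tx \in L by rewrite -index_mem; apply: leq_trans lt (index_size _ _).
  by rewrite !index_cat txL; case: ifP => // _; apply: leq_trans (leq_addr _ _); rewrite index_mem.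
(* When [L] extends [L'], anything before [tx'] in [L] already occurs in [L']. *)
move=> + tx'L'; rewrite !index_cat tx'L'; case: ifP => // _.
by move: tx'L'; rewrite -index_mem; lia.
Qed.

Theorem lemma3 (f : nat) (Tx : eqType) (c : config f Tx) (byz : {set node f})
    (e : nat -> gstate f Tx) :
  config_ok c -> #|byz| <= f ->
  execution c byz e -> acs_spec byz e -> partially_synchronous c byz e ->
  forall (i j : node f), i \notin byz -> j \notin byz -> forall k k' : nat,
    (forall tx tx' : Tx,
       delivers_before (ledger (e k) i) tx tx' -> tx' \in ledger (e k') j ->
       delivers_before (ledger (e k') j) tx tx')
    /\ (prefix (ledger (e k) i) (ledger (e k') j)
        || prefix (ledger (e k') j) (ledger (e k) i)).
Proof.
move=> c_ok byz_le exec acs _ i j iN jN k k'.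
suff pre : prefix (ledger (e k) i) (ledger (e k') j)
        || prefix (ledger (e k') j) (ledger (e k) i).
  by split=> // tx tx'; apply: delivers_before_prefix.
have facts := run_facts_execution byz_le exec acs.
have oi := ordering_execution byz_le exec acs k iN.
have oj := ordering_execution byz_le exec acs k' jN.
have ledger_prefix s s' : prefix s s' ->
    prefix (flatten (map (@payload f Tx) s)) (flatten (map (@payload f Tx) s')).
  by case/prefixP=> s1 ->; rewrite map_cat flatten_cat prefix_prefix.
(* The times [k] and [k'] are unrelated; the committed rounds tell which ledger is the prefix. *)
have [le_k|/ltnW le_k] := leqP (committed (loc (e k) i)) (committed (loc (e k') j)).
  by rewrite ledger_prefix // (ordering_prefix c_ok byz_le facts oi oj).
by rewrite orbC ledger_prefix // (ordering_prefix c_ok byz_le facts oj oi).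
Qed.
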